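(* Let $k\in\mathbb{Z}$ with $k\le-3$, let $j\in\{\frac{k+1}{2},\frac{k+2}{2},\dots,-\frac12\}$ and $s\in\mathbb{Z}$. Then there are isomorphisms of $\mathcal{U}(\widehat{\mathfrak{sl}}_2)$-modules $$\big(D^{k,s}_0\big)^\curlyvee\cong D^{k,-s}_0,\qquad \big(D^{+,k,s}_j\big)^\curlyvee\cong D^{-,k,-s}_j,\qquad \big(D^{-,k,s}_j\big)^\curlyvee\cong D^{+,k,-s}_j.$$
   Context: $\mathfrak{sl}_2$ has basis $J^+,J^-,J^0$ with $[J^+,J^-]=J^0$, $[J^0,J^\pm]=\pm2J^\pm$. For $j\in-\tfrac12\mathbb{N}$, $D^+_j$ is the $\mathfrak{sl}_2$-module with basis $\{|j,m\rangle_+\}_{m\ge0}$, $J^0|j,m\rangle_+=2(m-j)|j,m\rangle_+$, $J^+|j,m\rangle_+=\sqrt{(m+1)(m-2j)}|j,m+1\rangle_+$, $J^-|j,m\rangle_+=-\sqrt{m(m-1-2j)}|j,m-1\rangle_+$; $D^-_j$ has basis $\{|j,m\rangle_-\}_{m\ge0}$, $J^0|j,m\rangle_-=2(j-m)|j,m\rangle_-$, $J^+|j,m\rangle_-=-\sqrt{m(m-1-2j)}|j,m-1\rangle_-$, $J^-|j,m\rangle_-=\sqrt{(m+1)(m-2j)}|j,m+1\rangle_-$; $D_0=\mathbb{C}$ is the trivial module. $\widehat{\mathfrak{sl}}_2$ has generators $J^a_n$ ($a\in\{+,-,0\}$, $n\in\mathbb{Z}$), $K$, $d$ with $[J^+_m,J^-_n]=J^0_{m+n}+Km\delta_{m+n,0}$,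 $[J^0_m,J^\pm_n]=\pm2J^\pm_{m+n}$, $[J^0_m,J^0_n]=2Km\delta_{m+n,0}$, $[J^\pm_m,J^\pm_n]=0$, $[d,J^a_n]=nJ^a_n$, $K$ central; $J^a_0$ is identified with $J^a$. With $\mathfrak{r}_+=\mathrm{span}\{J^a_n:n\ge1\}$, $\mathfrak{k}=\mathrm{span}\{J^a_0,K,d\}$, the prolongation of $V\in\{D^\pm_j,D_0\}$ at level $k$ is $V^k=\mathcal{U}(\widehat{\mathfrak{sl}}_2)\otimes_{\mathcal{U}(\mathfrak{k}\oplus\mathfrak{r}_+)}V^{(k)}$, where on $V^{(k)}=V$, $K$ acts as $k$, $\mathfrak{r}_+$ as $0$, and $d$ by the scalar $-\frac{j(j+1)}{k+2}$ (for $D^\pm_j$) resp. $0$ (for $D_0$). The spectral flow automorphism $\vartheta_s$ is $J^\pm_n\mapsto J^\pm_{n\mp s}$, $J^0_n\mapsto J^0_n-sK\delta_{n,0}$, $K\mapsto K$, $d\mapsto d+\frac s2J^0_0-\frac{s^2}4K$; for a module $(W,\rho)$, $W^s=(W,\rho\circ\vartheta_s)$. Set $D^{\pm,k,s}_j=((D^\pm_j)^k)^s$, $D^{k,s}_0=((D_0)^k)^s$. Grading: for $V$ one of these modules, let $v_0=1\otimes|j,0\rangle_\pm$ resp. $1\otimes1$ be the distinguished cyclic vector, a simultaneous eigenvector of $d$ and $J^0_0$ (in $V$'s action) with eigenvalues $\delta_0,q_0$; set $V_{m,n}=\{v: dv=(\delta_0-m)v,\ J^0_0v=(q_0+2n)v\}$,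 so $V=\bigoplus_{m,n\in\mathbb{Z}}V_{m,n}$ with each $V_{m,n}$ finite dimensional. The contragredient is $V^\curlyvee=\bigoplus_{(m,n)}V_{m,n}^*$ (each $V_{m,n}^*$ extended by zero to the other graded pieces) with action $(J^a_n\varphi)(v)=-\varphi(J^a_{-n}v)$, $(K\varphi)(v)=\varphi(Kv)$, $(d\varphi)(v)=\varphi(dv)$. *)

(* Defs.v *)
From HB Require Import structures.
From mathcomp Require Import all_boot all_order all_algebra.
Set Implicit Arguments. Unset Strict Implicit. Unset Printing Implicit Defensive.
Import Order.TTheory GRing.Theory Num.Theory.
Local Open Scope ring_scope.

Record ghat_data (C : numClosedFieldType) := GData {
  gcar : lmodType C;
  Jp : int -> gcar -> gcar;
  Jm : int -> gcar -> gcar;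
  J0 : int -> gcar -> gcar;
  Kop : gcar -> gcar;
  dop : gcar -> gcar }.
Arguments Jp {C} g _ _. Arguments Jm {C} g _ _. Arguments J0 {C} g _ _.
Arguments Kop {C} g _. Arguments dop {C} g _.

Definition lin (C : numClosedFieldType) (U V : lmodType C) (f : U -> V) :=
  forall (a : C) (u v : U), f (a *: u + v) = a *: f u + f v.

Definition delta0 (C : numClosedFieldType) (V : lmodType C) (n : int) (x : V) : V :=
  if n == 0 then x else 0.

Definition is_rep (C : numClosedFieldType) (M : ghat_data C) : Prop :=
  (forall n, lin (Jp M n)) /\ (forall n, lin (Jm M n)) /\ (forall n, lin (J0 M n)) /\
  lin (Kop M) /\ lin (dop M) /\
  (forall (m n : int) v, Jp M m (Jm M n v) - Jm M n (Jp M m v)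
                         = J0 M (m + n) v + delta0 (m + n) (m%:~R *: Kop M v)) /\
  (forall (m n : int) v, J0 M m (Jp M n v) - Jp M n (J0 M m v) = 2 *: Jp M (m + n) v) /\
  (forall (m n : int) v, J0 M m (Jm M n v) - Jm M n (J0 M m v) = - (2 *: Jm M (m + n) v)) /\
  (forall (m n : int) v, J0 M m (J0 M n v) - J0 M n (J0 M m v)
                         = delta0 (m + n) ((2 * m%:~R) *: Kop M v)) /\
  (forall (m n : int) v, Jp M m (Jp M n v) = Jp M n (Jp M m v)) /\
  (forall (m n : int) v, Jm M m (Jm M n v) = Jm M n (Jm M m v)) /\
  (forall (n : int) v, dop M (Jp M n v) - Jp M n (dop M v) = n%:~R *: Jp M n v) /\
  (forall (n : int) v, dop M (Jm M n v) - Jm M n (dop M v) = n%:~R *: Jm M n v) /\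
  (forall (n : int) v, dop M (J0 M n v) - J0 M n (dop M v) = n%:~R *: J0 M n v) /\
  (forall (n : int) v, Kop M (Jp M n v) = Jp M n (Kop M v)) /\
  (forall (n : int) v, Kop M (Jm M n v) = Jm M n (Kop M v)) /\
  (forall (n : int) v, Kop M (J0 M n v) = J0 M n (Kop M v)) /\
  (forall v, Kop M (dop M v) = dop M (Kop M v)).

Definition gmap (C : numClosedFieldType) (M N : ghat_data C) (f : gcar M -> gcar N) :=
  lin f /\
  (forall n v, f (Jp M n v) = Jp N n (f v)) /\
  (forall n v, f (Jm M n v) = Jm N n (f v)) /\
  (forall n v, f (J0 M n v) = J0 N n (f v)) /\
  (forall v, f (Kop M v) = Kop N (f v)) /\
  (forall v, f (dop M v) = dop N (f v)).

(* Twist by the spectral flow automorphism theta_s: W^s = (W, rho o theta_s). *)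
Definition sflow (C : numClosedFieldType) (s : int) (M : ghat_data C) : ghat_data C :=
  @GData C (gcar M)
    (fun n => Jp M (n - s))
    (fun n => Jm M (n + s))
    (fun n v => J0 M n v - delta0 n (s%:~R *: Kop M v))
    (Kop M)
    (fun v => dop M v + (s%:~R / 2) *: J0 M 0 v - (s%:~R ^+ 2 / 4) *: Kop M v).

(* A linear functional on M lies in the restricted dual  (+)_{weights} V_w^*  :
   it vanishes on all but finitely many joint (d, J^0_0)-eigenspaces of M. *)
Definition restricted (C : numClosedFieldType) (M : ghat_data C) (phi : gcar M -> C) :=
  exists S : seq (C * C), forall v (l q : C),
    dop M v = l *: v -> J0 M 0 v = q *: v -> (l, q) \notin S -> phi v = 0.

Arguments restricted {C} M phi.
Definition lin_form (C : numClosedFieldType) (U : lmodType C) (phi : U -> C) :=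
  forall (a : C) (u v : U), phi (a *: u + v) = a * phi u + phi v.

(* contra_iso M N :  N is isomorphic, as sl2^-module, to the contragredient M^v,
   with action (J^a_n phi)(v) = - phi(J^a_{-n} v), (K phi)(v) = phi(K v),
   (d phi)(v) = phi(d v). *)
Definition contra_iso (C : numClosedFieldType) (M N : ghat_data C) : Prop :=
  exists F : gcar N -> gcar M -> C,
    (forall w, lin_form (F w) /\ restricted M (F w)) /\
    (forall (a : C) u w v, F (a *: u + w) v = a * F u v + F w v) /\
    (forall u w, (forall v, F u v = F w v) -> u = w) /\
    (forall phi, lin_form phi -> restricted M phi -> exists w, forall v, F w v = phi v) /\
    (forall n w v, F (Jp N n w) v = - F w (Jp M (- n) v)) /\
    (forall n w v, F (Jm N n w) v = - F w (Jm M (- n) v)) /\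
    (forall n w v, F (J0 N n w) v = - F w (J0 M (- n) v)) /\
    (forall w v, F (Kop N w) v = F w (Kop M v)) /\
    (forall w v, F (dop N w) v = F w (dop M v)).

Arguments gmap {C} M N f.
(* j is encoded by j2 = 2j : int; the d-eigenvalue on V^(k) is -j(j+1)/(k+2). *)
Definition jC (C : numClosedFieldType) (j2 : int) : C := j2%:~R / 2.
Definition dval (C : numClosedFieldType) (k j2 : int) : C :=
  - (jC C j2 * (jC C j2 + 1)) / (k%:~R + 2).

(* Common part of the (k + r_+)-action on V^(k): K = k, d = scalar, r_+ = 0. *)
Definition pcommon (C : numClosedFieldType) (k : int) (dv : C) (M : ghat_data C)
  (x : gcar M) :=
  Kop M x = k%:~R *: x /\ dop M x = dv *: x /\
  (forall n : int, 0 < n -> Jp M n x = 0 /\ Jm M n x = 0 /\ J0 M n x = 0).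

(* u : nat -> M is the image of the basis |j,m>_+ under a p-module map D^+_j^(k) -> M. *)
Definition pmap_plus (C : numClosedFieldType) (k j2 : int) (M : ghat_data C)
  (u : nat -> gcar M) :=
  forall m : nat,
    pcommon k (dval C k j2) (u m) /\
    J0 M 0 (u m) = (2 * (m%:R - jC C j2)) *: u m /\
    Jp M 0 (u m) = sqrtC ((m.+1)%:R * (m%:R - j2%:~R)) *: u m.+1 /\
    Jm M 0 (u m) = - (sqrtC (m%:R * (m%:R - 1 - j2%:~R)) *: u m.-1).

Definition pmap_minus (C : numClosedFieldType) (k j2 : int) (M : ghat_data C)
  (u : nat -> gcar M) :=
  forall m : nat,
    pcommon k (dval C k j2) (u m) /\
    J0 M 0 (u m) = (2 * (jC C j2 - m%:R)) *: u m /\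
    Jp M 0 (u m) = - (sqrtC (m%:R * (m%:R - 1 - j2%:~R)) *: u m.-1) /\
    Jm M 0 (u m) = sqrtC ((m.+1)%:R * (m%:R - j2%:~R)) *: u m.+1.

(* For the trivial module D_0 = C: image u of 1. *)
Definition pmap_triv (C : numClosedFieldType) (k : int) (M : ghat_data C) (u : gcar M) :=
  pcommon k 0 u /\ Jp M 0 u = 0 /\ Jm M 0 u = 0 /\ J0 M 0 u = 0.

(* Prolongation V^k = U(sl2^) (x)_{U(k + r_+)} V^(k), characterized by its universal
   property (Frobenius reciprocity): (W, w) is the induced module iff for every
   sl2^-module M and every p-module map u from V^(k) to M there is a unique
   sl2^-module map f : W -> M extending u. *)
Definition is_prolong_plus (C : numClosedFieldType) (k j2 : int) (W : ghat_data C)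
  (w : nat -> gcar W) :=
  is_rep W /\ pmap_plus k j2 w /\
  forall (M : ghat_data C) (u : nat -> gcar M), is_rep M -> pmap_plus k j2 u ->
    exists f, gmap W M f /\ (forall m, f (w m) = u m) /\
      forall g, gmap W M g -> (forall m, g (w m) = u m) -> forall x, g x = f x.

Definition is_prolong_minus (C : numClosedFieldType) (k j2 : int) (W : ghat_data C)
  (w : nat -> gcar W) :=
  is_rep W /\ pmap_minus k j2 w /\
  forall (M : ghat_data C) (u : nat -> gcar M), is_rep M -> pmap_minus k j2 u ->
    exists f, gmap W M f /\ (forall m, f (w m) = u m) /\
      forall g, gmap W M g -> (forall m, g (w m) = u m) -> forall x, g x = f x.

Definition is_prolong_triv (C : numClosedFieldType) (k : int) (W : ghat_data C)
  (w : gcar W) :=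
  is_rep W /\ pmap_triv k w /\
  forall (M : ghat_data C) (u : gcar M), is_rep M -> pmap_triv k u ->
    exists f, gmap W M f /\ f w = u /\
      forall g, gmap W M g -> g w = u -> forall x, g x = f x.

Arguments is_prolong_plus {C} k j2 W w.
Arguments is_prolong_minus {C} k j2 W w.
Arguments is_prolong_triv {C} k W w.

(* Main.v *)
(* By Frobenius reciprocity each prolongation is the universal module on a lowest weight
   vector of weight -2j (after exchanging J^+ and J^- in the case of D^-_j). The spectral
   flow only relabels weights, so s = 0 suffices.

   Contravariant pairing: g = n + q with q acting on the lowest weight vector through a
   character. A functional on words in the generators that kills n on the left and sees q
   on the right through that character is defined by moving the leftmost letter to the
   right; it respects the commutation relations, and so yields both a non-zero module with
   such a vector and an extremal vector in the full dual of the prolongation, hence the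
   pairing between the two prolongations.

   Non-degeneracy: the Sugawara operator 2(k+2)d + C_0 + 2 (C_1 + C_2 + ...) vanishes on
   the prolongation. On a singular vector m steps below the top and with charge n it gives
   n^2 - n(2j+1) = m(k+2) with n >= -m, and for k <= -3 and k+1 <= 2j <= 0 this leaves only
   the top. So non-zero submodules contain the lowest weight vector and both radicals of
   the pairing vanish; finite-dimensionality of the weight spaces does the rest. *)
Require Import Defs.
From HB Require Import structures.
From mathcomp Require Import all_boot all_order all_algebra.
From mathcomp Require Import boolp functions.
From mathcomp Require Import zify ring.
Set Implicit Arguments. Unset Strict Implicit. Unset Printing Implicit Defensive.
Import Order.TTheory GRing.Theory Num.Theory.
Local Open Scope ring_scope.

(** * Linear maps and submodules *)

Section LinearMaps.
Variables (C : numClosedFieldType) (U V : lmodType C) (f : U -> V).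
Hypothesis lf : lin f.

Lemma lin0 : f 0 = 0.
Proof. by have := lf (-1) 0 0; rewrite scaler0 addr0 scaleN1r addNr. Qed.

Lemma linD u v : f (u + v) = f u + f v.
Proof. by have := lf 1 u v; rewrite !scale1r. Qed.

Lemma linZ a u : f (a *: u) = a *: f u.
Proof. by have := lf a u 0; rewrite !addr0 lin0 addr0. Qed.

Lemma linN u : f (- u) = - f u.
Proof. by rewrite -scaleN1r linZ scaleN1r. Qed.

Lemma linB u v : f (u - v) = f u - f v.
Proof. by rewrite linD linN. Qed.

Lemma lin_sum (I : Type) (r : seq I) (P : pred I) (F : I -> U) :
  f (\sum_(i <- r | P i) F i) = \sum_(i <- r | P i) f (F i).
Proof. by elim/big_rec2: _ => [|i u v _ <-]; rewrite ?lin0 ?linD. Qed.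

End LinearMaps.

Lemma lin_form0 (C : numClosedFieldType) (V : lmodType C) (phi : V -> C) :
  lin_form phi -> phi 0 = 0.
Proof. by move=> lphi; have := lphi (-1) 0 0; rewrite scaler0 addr0 => {1}->; ring. Qed.

Definition subspace (C : numClosedFieldType) (V : lmodType C) (P : V -> Prop) :=
  P 0 /\ forall a u v, P u -> P v -> P (a *: u + v).

Section Subspace.
Variables (C : numClosedFieldType) (V : lmodType C) (P : V -> Prop).
Hypothesis sP : subspace P.

Lemma subspaceZ a u : P u -> P (a *: u).
Proof. by move=> Pu; rewrite -[_ *: _]addr0; apply: sP.2 => //; exact: sP.1. Qed.

Lemma subspaceD u v : P u -> P v -> P (u + v).
Proof. by move=> Pu Pv; rewrite -[u]scale1r; apply: sP.2. Qed.

Lemma subspaceN u : P u -> P (- u).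
Proof. by move=> Pu; rewrite -scaleN1r; apply: subspaceZ. Qed.

Lemma subspaceB u v : P u -> P v -> P (u - v).
Proof. by move=> Pu Pv; apply/subspaceD/subspaceN. Qed.

Lemma subspace_sum (I : Type) (r : seq I) (Q : pred I) (F : I -> V) :
  (forall i, Q i -> P (F i)) -> P (\sum_(i <- r | Q i) F i).
Proof. by move=> PF; elim/big_ind: _ => //; [exact: sP.1 | exact: subspaceD]. Qed.

End Subspace.

(** Classical truth turns [P] into a boolean predicate; keeping the proof [sP] in it lets the
    submodule structure be found by inference. *)
Definition spred (C : numClosedFieldType) (V : lmodType C) (P : V -> Prop)
  (sP : subspace P) : {pred V} := fun v => `[<P v>].

Section SubmodType.
Variables (C : numClosedFieldType) (V : lmodType C) (P : V -> Prop).
Variable sP : subspace P.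

Lemma spred_submod : submod_closed (spred sP).
Proof.
split=> [|a u v /asboolP Pu /asboolP Pv]; first by apply/asboolP; exact: sP.1.
by apply/asboolP; exact: sP.2.
Qed.

HB.instance Definition _ := GRing.isSubmodClosed.Build C V (spred sP) spred_submod.

Record submod := Submod { smval : V; smvalP : smval \in spred sP }.
HB.instance Definition _ := [isSub for smval].
HB.instance Definition _ := [Choice of submod by <:].
HB.instance Definition _ := [SubChoice_isSubLmodule of submod by <:].

Lemma smP (x : submod) : P (smval x).
Proof. by apply/asboolP; exact: smvalP x. Qed.

Definition smk (v : V) (Pv : P v) : submod := @Submod v (introT (asboolP _) Pv).

Lemma smval_lin : lin smval. Proof. by move=> a u v. Qed.

Lemma smval_inj : injective smval. Proof. exact: val_inj. Qed.

End SubmodType.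

(** * Generators and representations *)

(** With one type of letters the clauses of [is_rep] collapse into linearity and a single bracket
    identity, and words can be treated uniformly. *)
Inductive gen := Ep of int | Em of int | Eh of int | Ek | Ed.

Section Generators.
Variable C : numClosedFieldType.
Implicit Types (M : ghat_data C) (x y : gen).

Definition act M x : gcar M -> gcar M :=
  match x with
  | Ep n => Jp M n | Em n => Jm M n | Eh n => J0 M n | Ek => Kop M | Ed => dop M
  end.

Arguments act : clear implicits.

Definition gdata (V : lmodType C) (op : gen -> V -> V) : ghat_data C :=
  @GData C V (fun n => op (Ep n)) (fun n => op (Em n)) (fun n => op (Eh n))
    (op Ek) (op Ed).

Lemma act_gdata (V : lmodType C) (op : gen -> V -> V) x : act (gdata op) x = op x.
Proof. by case: x. Qed.

(* Zero coefficients of the central term are dropped, so that the letters occurring in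
   [br x y] stay in any subalgebra that is spanned by generators and contains x and y. *)
Definition central (n : int) (c : C) : seq (C * gen) :=
  if n == 0 then [:: (c, Ek)] else [::].

Definition br x y : seq (C * gen) :=
  match x, y with
  | Ep m, Em n => (1, Eh (m + n)) :: central (m + n) m%:~R
  | Em m, Ep n => (-1, Eh (m + n)) :: central (m + n) m%:~R
  | Eh m, Ep n => [:: (2, Ep (m + n))]
  | Ep m, Eh n => [:: (-2, Ep (m + n))]
  | Eh m, Em n => [:: (-2, Em (m + n))]
  | Em m, Eh n => [:: (2, Em (m + n))]
  | Eh m, Eh n => central (m + n) (2 * m%:~R)
  | Ed, Ep n => [:: (n%:~R, Ep n)]
  | Ed, Em n => [:: (n%:~R, Em n)]
  | Ed, Eh n => [:: (n%:~R, Eh n)]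
  | Ep n, Ed => [:: (- n%:~R, Ep n)]
  | Em n, Ed => [:: (- n%:~R, Em n)]
  | Eh n, Ed => [:: (- n%:~R, Eh n)]
  | _, _ => [::]
  end.

Definition evm (V : lmodType C) (phi : gen -> V) (s : seq (C * gen)) : V :=
  \sum_(p <- s) p.1 *: phi p.2.

Definition grep M :=
  (forall x, lin (act M x)) /\
  forall x y v, act M x (act M y v) - act M y (act M x v)
                = evm (fun z => act M z v) (br x y).

Lemma evm_central (V : lmodType C) (phi : gen -> V) n c :
  evm phi (central n c) = delta0 n (c *: phi Ek).
Proof.
by rewrite /evm /central /delta0; case: eqP => _; rewrite ?big_seq1 ?big_nil.
Qed.

Lemma evm_cons (V : lmodType C) (phi : gen -> V) p s :
  evm phi (p :: s) = p.1 *: phi p.2 + evm phi s.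
Proof. exact: big_cons. Qed.

Lemma evm_nil (V : lmodType C) (phi : gen -> V) : evm phi [::] = 0.
Proof. exact: big_nil. Qed.

Definition evmE := (evm_cons, evm_central, evm_nil).

Lemma is_rep_grep M : is_rep M <-> grep M.
Proof.
split=> [[lp [lm [lh [lk [ld [pm [hp [hm [hh [pp [mm [dp [dm [dh [kp [km [kh kd]]]]]]]]]]]]]]]]]|].
  split=> [[n|n|n||]|] //; first exact: lp; first exact: lm; first exact: lh.
  have sw (a b c : gcar M) : a - b = c -> b - a = - c by move<-; rewrite opprB.
  case=> [m|m|m||] [n|n|n||] v /=; rewrite !evmE /= ?addr0 ?scale1r ?scaleNr ?scale1r;
    try by first [rewrite subrr | rewrite pp subrr | rewrite mm subrr | rewrite kp subrr
      | rewrite km subrr | rewrite kh subrr | rewrite kd subrr | rewrite pm | rewrite hp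
      | rewrite hm | rewrite hh | rewrite dp | rewrite dm | rewrite dh].
  - by apply: sw; rewrite hp addrC.
  - by apply: sw; rewrite dp.
  - rewrite (sw _ _ _ (pm _ _ _)) opprD [n + m]addrC; congr (_ + _).
    rewrite /delta0; case: eqP => [e|_]; last by rewrite oppr0.
    by rewrite -scaleNr -mulrNz; congr (_%:~R *: _); lia.
  - by rewrite (sw _ _ _ (hm _ _ _)) opprK addrC.
  - by apply: sw; rewrite dm.
  - by apply: sw; rewrite dh.
case=> la com.
do 5!(split; first by [move=> n; apply: (la (Ep n)) | move=> n; apply: (la (Em n)) |
  move=> n; apply: (la (Eh n)) | apply: (la Ek) | apply: (la Ed)]).
split=> [m n v|].
  by have := com (Ep m) (Em n) v; rewrite /= !evmE /= scale1r.
split=> [m n v|].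
  by have := com (Eh m) (Ep n) v; rewrite /= !evmE /= addr0.
split=> [m n v|].
  by have := com (Eh m) (Em n) v; rewrite /= !evmE /= addr0 scaleNr.
split=> [m n v|].
  by have := com (Eh m) (Eh n) v; rewrite /= !evmE.
split=> [m n v|].
  by have := com (Ep m) (Ep n) v; rewrite /= !evmE; apply: subr0_eq.
split=> [m n v|].
  by have := com (Em m) (Em n) v; rewrite /= !evmE; apply: subr0_eq.
split=> [n v|].
  by have := com Ed (Ep n) v; rewrite /= !evmE /= addr0.
split=> [n v|].
  by have := com Ed (Em n) v; rewrite /= !evmE /= addr0.
split=> [n v|].
  by have := com Ed (Eh n) v; rewrite /= !evmE /= addr0.
split=> [n v|].
  by have := com Ek (Ep n) v; rewrite /= !evmE; apply: subr0_eq.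
split=> [n v|].
  by have := com Ek (Em n) v; rewrite /= !evmE; apply: subr0_eq.
split=> [n v|].
  by have := com Ek (Eh n) v; rewrite /= !evmE; apply: subr0_eq.
by move=> v; have := com Ek Ed v; rewrite /= !evmE; apply: subr0_eq.
Qed.

Lemma gmap_act M N (f : gcar M -> gcar N) :
  gmap M N f <-> lin f /\ forall x v, f (act M x v) = act N x (f v).
Proof.
split=> [[lf [fp [fm [fh [fk fd]]]]]|[lf fa]].
  by split=> // -[n|n|n||] v /=.
split=> //; split=> [n v|]; first exact: (fa (Ep n)).
split=> [n v|]; first exact: (fa (Em n)).
split=> [n v|]; first exact: (fa (Eh n)).
by split=> v; [exact: (fa Ek) | exact: (fa Ed)].
Qed.

End Generators.
Arguments act {C} M x _.
Arguments br {C} x y.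
Arguments grep {C} M.

Section SubRep.
Variables (C : numClosedFieldType) (V : lmodType C) (op : gen -> V -> V).
Variables (P : V -> Prop) (sP : subspace P).
Hypothesis lop : forall x, lin (op x).
Hypothesis Pop : forall x v, P v -> P (op x v).
Hypothesis comP : forall x y v, P v ->
  op x (op y v) - op y (op x v) = evm (fun z => op z v) (br x y).

(** The commutation relations are demanded on [P] only: in the function spaces used below they are
    established on a subspace of suitable functionals. *)
Definition sub_rep : ghat_data C :=
  gdata (fun x (v : submod sP) => smk sP (Pop x (smP v))).

Lemma smval_act x (v : gcar sub_rep) : smval (act sub_rep x v) = op x (smval v).
Proof. by rewrite act_gdata. Qed.

Lemma sub_rep_grep : grep sub_rep.
Proof.
split=> [x a u v|x y v]; apply: smval_inj.
  by rewrite smval_lin !smval_act smval_lin lop.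
rewrite (linB (@smval_lin _ _ _ sP)) !smval_act comP; last exact: smP.
rewrite /evm (lin_sum (@smval_lin _ _ _ sP)); apply: eq_bigr => p _.
by rewrite (linZ (@smval_lin _ _ _ sP)) smval_act.
Qed.

End SubRep.

(** * The vacuum functional on words *)

Section VacuumFunctional.
Variables (R : comPzRingType) (T : Type).
Implicit Types (a b c x : T) (y z t : seq T) (s : seq (R * T)).

Definition ev (phi : T -> R) s : R := \sum_(p <- s) p.1 * phi p.2.

Lemma eq_ev phi psi s : phi =1 psi -> ev phi s = ev psi s.
Proof. by move=> e; apply: eq_bigr => p _; rewrite e. Qed.

Lemma evD phi psi s : ev (fun x => phi x + psi x) s = ev phi s + ev psi s.
Proof. by rewrite /ev -big_split; apply: eq_bigr => p _; rewrite mulrDr. Qed.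

Lemma evZ (c : R) phi s : ev (fun x => c * phi x) s = c * ev phi s.
Proof. by rewrite /ev mulr_sumr; apply: eq_bigr => p _; rewrite mulrCA. Qed.

Lemma ev0 s : ev (fun=> 0) s = 0.
Proof. by rewrite /ev big1 // => p _; rewrite mulr0. Qed.

Lemma ev_all (Q : pred T) phi psi s :
  (forall x, Q x -> phi x = psi x) -> all (fun p => Q p.2) s -> ev phi s = ev psi s.
Proof.
move=> e; elim: s => [|p s IH] /=; first by rewrite /ev !big_nil.
by case/andP=> Qp /IH; rewrite /ev !big_cons e // => ->.
Qed.

Variable brk : T -> T -> seq (R * T).

(* [dder a phi y] is phi applied to the derivation ad(a) of the word y. *)
Fixpoint dder a (phi : seq T -> R) y : R :=
  if y is b :: z then
    ev (fun x => phi (x :: z)) (brk a b) + dder a (fun t => phi (b :: t)) z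
  else 0.

Lemma dder_ext a phi psi y :
  (forall t, size t = size y -> phi t = psi t) -> dder a phi y = dder a psi y.
Proof.
elim: y phi psi => [|b z IH] phi psi e //=; congr (_ + _).
  by apply: eq_ev => x; apply: e.
by apply: IH => t st; apply: e; rewrite /= st.
Qed.

Lemma dderD a phi psi y :
  dder a (fun t => phi t + psi t) y = dder a phi y + dder a psi y.
Proof.
elim: y phi psi => [|b z IH] phi psi /=; first by rewrite addr0.
by rewrite evD IH addrACA.
Qed.

Lemma dderZ a (c : R) phi y : dder a (fun t => c * phi t) y = c * dder a phi y.
Proof.
elim: y phi => [|b z IH] phi /=; first by rewrite mulr0.
by rewrite evZ IH mulrDr.
Qed.

Lemma dder0 a y : dder a (fun=> 0) y = 0.
Proof. by elim: y => //= b z ->; rewrite ev0 addr0. Qed.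

Lemma dder_ev a (phi : T -> seq T -> R) s y :
  dder a (fun t => ev (fun x => phi x t) s) y = ev (fun x => dder a (phi x) y) s.
Proof.
elim: s => [|p s IH].
  rewrite [RHS]big_nil -(dder0 a y); apply: dder_ext => t _.
  by rewrite /ev big_nil.
rewrite [RHS]big_cons -dderZ -[X in _ + X]IH -dderD.
by apply: dder_ext => t _; rewrite /ev big_cons.
Qed.

Lemma dder_cat a phi y z :
  dder a phi (y ++ z) =
  dder a (fun t => phi (t ++ z)) y + dder a (fun t => phi (y ++ t)) z.
Proof.
by elim: y phi => [|b y IH] phi /=; rewrite ?add0r // IH addrA.
Qed.

Hypothesis antisym : forall phi a b, ev phi (brk a b) = - ev phi (brk b a).
Hypothesis jacobi : forall phi a b c,
  ev (fun x => ev phi (brk c x)) (brk a b) =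
  ev (fun x => ev phi (brk x b)) (brk c a) + ev (fun x => ev phi (brk a x)) (brk c b).

(** Functionals carry the transpose of the adjoint action, whence the reversed bracket. Terms where
    [a] and [b] hit different letters cancel; on a single letter the identity is Jacobi. *)
Lemma dder_comm a b phi y :
  dder a (dder b phi) y - dder b (dder a phi) y = ev (fun x => dder x phi y) (brk b a).
Proof.
elim: y phi => [|c y IH] phi /=; first by rewrite subrr ev0.
rewrite 2!dderD 3!evD 2!dder_ev -(IH (fun t => phi (c :: t))) jacobi.
ring.
Qed.

Variables (q l : pred T) (chi : T -> R).
Hypothesis qbr : forall a b, q a -> q b -> all (fun p => q p.2) (brk a b).
Hypothesis nbr : forall a b, ~~ q a -> ~~ q b -> all (fun p => ~~ q p.2) (brk a b).
Hypothesis chibr : forall a b, q a -> q b -> ev chi (brk a b) = 0.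
Hypothesis lq : forall a, l a -> q a.
Hypothesis lnbr : forall a b, l a -> ~~ q b -> all (fun p => ~~ q p.2) (brk a b).

(** The fuel is the length of the word: [dder] evaluates at other words as long as [z], so the
    recursion is not structural. With that fuel only the empty word, normalised to 1, meets the last
    branch. *)
Fixpoint vacn (n : nat) y : R :=
  match n, y with
  | n'.+1, a :: z => if q a then dder a (vacn n') z + chi a * vacn n' z else 0
  | _, _ => 1
  end.

(* The recursion is forced by vac(n y) = 0 for n outside q and vac(y a) = chi(a) vac(y)
   for a in q; that it respects the commutation relations replaces the PBW theorem. *)
Definition vac y := vacn (size y) y.

Lemma vac_cons a y : vac (a :: y) = if q a then dder a vac y + chi a * vac y else 0.
Proof.
rewrite /vac /=; case: (q a) => //; congr (_ + _).
by apply: dder_ext => t ->.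
Qed.

(** Induction on the length of the prefix. A first letter outside [q] kills every term. One inside
    acts as a derivation: on the rest of the prefix and on the tail the induction hypothesis
    applies, on [a] and [b] the Jacobi identity. *)
Lemma vac_swap y a b z :
  vac (y ++ a :: b :: z) - vac (y ++ b :: a :: z)
  = ev (fun x => vac (y ++ x :: z)) (brk a b).
Proof.
have [n] := ubnP (size y); elim: n y a b z => // n IH [|c y] a b z /= ltn.
  have E (Q : pred T) := @ev_all Q (fun x => vac (x :: z)).
  rewrite ![vac (_ :: _ :: _)]vac_cons.
  (* Two letters of [q]: [dder_comm], with [chi] vanishing on the bracket. Exactly one: the
     recursion itself produces the bracket. None: the bracket stays outside [q] and everything
     vanishes. *)
  case qa: (q a); case qb: (q b).
  - have qE : ev (fun x => vac (x :: z)) (brk a b) = ev (fun x => dder x vac z) (brk a b).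
      rewrite (E q (fun x => dder x vac z + vac z * chi x)); first last.
      - exact: qbr.
      - by move=> x qx; rewrite vac_cons qx mulrC.
      by rewrite evD evZ chibr // mulr0 addr0.
    rewrite qE -dder_comm /=.
    have D c d : q c -> dder d (fun t => vac (c :: t)) z
        = dder d (dder c vac) z + chi c * dder d vac z.
      by move=> qc; rewrite -dderZ -dderD; apply: dder_ext => t _; rewrite vac_cons qc.
    rewrite !D // !vac_cons qa qb (antisym _ b a).
    by rewrite qE -dder_comm; ring.
  - have D : dder a (fun t => vac (b :: t)) z = 0.
      by rewrite -(dder0 a z); apply: dder_ext => t _; rewrite vac_cons qb.
    by rewrite /= D vac_cons qb; ring.
  - have D : dder b (fun t => vac (a :: t)) z = 0.
      by rewrite -(dder0 b z); apply: dder_ext => t _; rewrite vac_cons qa.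
    by rewrite /= D vac_cons qa antisym; ring.
  - rewrite (E (predC q) (fun=> 0)) ?ev0 ?subrr //.
      by move=> x /negbTE nx; rewrite vac_cons nx.
    by apply: nbr; rewrite ?qa ?qb.
rewrite !vac_cons; case: (boolP (q c)) => qc; last first.
  by rewrite subrr -(ev0 (brk a b)); apply: eq_ev => x; rewrite vac_cons (negbTE qc).
rewrite (eq_ev (psi := fun x => dder c vac (y ++ x :: z) + chi c * vac (y ++ x :: z)));
  last by move=> x; rewrite vac_cons qc.
have IHs t : size t = size y -> forall a b z, vac (t ++ a :: b :: z)
    = vac (t ++ b :: a :: z) + ev (fun x => vac (t ++ x :: z)) (brk a b).
  by move=> st a' b' z'; rewrite -IH ?st // addrC subrK.
rewrite evD evZ -IH //.
have swD : forall b' c', ev (fun x => vac (y ++ x :: b' :: z)) (brk c c')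
   = ev (fun x => vac (y ++ b' :: x :: z)) (brk c c')
     + ev (fun x => ev (fun u => vac (y ++ u :: z)) (brk x b')) (brk c c').
  by move=> b' c'; rewrite -evD; apply: eq_ev => x; rewrite IHs.
have swD' : forall b' c', ev (fun x => vac (y ++ b' :: x :: z)) (brk c c')
   = ev (fun x => vac (y ++ x :: b' :: z)) (brk c c')
     + ev (fun x => ev (fun u => vac (y ++ u :: z)) (brk b' x)) (brk c c').
  by move=> b' c'; rewrite -evD; apply: eq_ev => x; rewrite IHs.
have -> : ev (fun x => dder c vac (y ++ x :: z)) (brk a b)
  = dder c (fun t => ev (fun x => vac (t ++ x :: z)) (brk a b)) y
    + ev (fun x => ev (fun u => vac (y ++ u :: z)) (brk c x)) (brk a b)
    + dder c (fun t => ev (fun x => vac (y ++ x :: t)) (brk a b)) z.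
  rewrite !dder_ev -!evD; apply: eq_ev => x.
  by rewrite dder_cat /= addrA.
rewrite !dder_cat /=.
rewrite (@dder_ext _ (fun t => vac (t ++ a :: b :: z)) (fun t =>
  vac (t ++ b :: a :: z) + ev (fun x => vac (t ++ x :: z)) (brk a b))); last first.
  by move=> t st; rewrite IHs.
rewrite (@dder_ext _ (fun t => vac (y ++ a :: b :: t)) (fun t =>
  vac (y ++ b :: a :: t) + ev (fun x => vac (y ++ x :: t)) (brk a b))); last first.
  by move=> t st; rewrite IHs.
rewrite !dderD jacobi (swD b a) (swD' a b).
ring.
Qed.

(** If the first letter is outside [q], so is its bracket with [a]. If it is in [q], its derivation
    can be exchanged with that of [a] and the claim reduces to shorter words. *)
Lemma dder_vac a y : l a -> dder a vac y = 0.
Proof.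
move=> la; have [n] := ubnP (size y); elim: n y => // n IH [|b y] //= ltn.
case: (boolP (q b)) => qb; last first.
  rewrite (ev_all (Q := predC q) (psi := fun=> 0)); last exact: lnbr.
    rewrite ev0 add0r -(dder0 a y); apply: dder_ext => t _.
    by rewrite vac_cons (negbTE qb).
  by move=> x /negbTE nx; rewrite vac_cons nx.
rewrite (ev_all (Q := q) (psi := fun x => dder x vac y + vac y * chi x)); first last.
- exact/qbr/qb/lq.
- by move=> x qx; rewrite vac_cons qx mulrC.
rewrite evD evZ (chibr (lq la) qb) mulr0 addr0 -dder_comm.
rewrite (@dder_ext _ (fun t => vac (b :: t)) (fun t => dder b vac t + chi b * vac t)); last first.
  by move=> t _; rewrite vac_cons qb.
rewrite dderD dderZ IH // mulr0 addr0 subrK -(dder0 b y).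
by apply: dder_ext => t st; rewrite IH // st.
Qed.

Lemma vac_lcons a y : l a -> vac (a :: y) = chi a * vac y.
Proof. by move=> la; rewrite vac_cons lq // dder_vac // add0r. Qed.

(** Carrying [a] from the front to the end costs [dder a vac y], which is exactly the derivation
    term in the recursion for [vac (a :: y)]. *)
Lemma vac_rcons a y : q a -> vac (rcons y a) = chi a * vac y.
Proof.
have mv z : forall p, vac (p ++ a :: z)
    = vac (p ++ rcons z a) + dder a (fun t => vac (p ++ t)) z.
  elim: z => [|b z IH] p /=; first by rewrite addr0.
  have := vac_swap p a b z => /eqP; rewrite subr_eq => /eqP ->.
  rewrite -[p ++ b :: a :: z]cat_rcons IH -cat_rcons.
  rewrite (@dder_ext _ _ (fun t => vac (p ++ b :: t))); first by ring.
  by move=> t _; rewrite cat_rcons.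
move=> qa; have := mv y [::]; rewrite /= vac_cons qa addrC.
move/addIr => <- //.
Qed.

End VacuumFunctional.

(** * Antisymmetry and Jacobi identity of the affine bracket *)

Section AffineBracket.
Variable C : numClosedFieldType.
Implicit Types (phi : gen -> C) (a b c : gen).

Lemma ev_cons phi (p : C * gen) s : ev phi (p :: s) = p.1 * phi p.2 + ev phi s.
Proof. exact: big_cons. Qed.

Lemma ev_nil phi : ev phi ([::] : seq (C * gen)) = 0.
Proof. exact: big_nil. Qed.

Lemma ev_central phi n (c : C) : ev phi (central n c) = (n == 0)%:R * (c * phi Ek).
Proof. by rewrite /central; case: eqP => _; rewrite ?ev_cons ev_nil /=; ring. Qed.

Definition evE := (ev_cons, ev_nil, ev_central).

Lemma br_antisym phi a b : ev phi (br a b) = - ev phi (br b a).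
Proof.
case: a b => [m|m|m||] [n|n|n||] /=; rewrite ?evE /= ?[n + m]addrC; try ring;
  case: eqP => [e|_] /=; try ring;
  by (have -> : n = - m by lia); ring.
Qed.

Lemma br_jacobi phi a b c :
  ev (fun x => ev phi (br c x)) (br a b) =
  ev (fun x => ev phi (br x b)) (br c a) + ev (fun x => ev phi (br a x)) (br c b).
Proof.
case: a b c => [m|m|m||] [n|n|n||] [p|p|p||] /=;
  rewrite ?evE /= ?evE /= ?addrA ?[m + p]addrC; try ring;
  case: eqP => [e|_] /=; try ring;
  first [have -> : p = - (m + n) by lia | have -> : m = - n by lia
  | have -> : p = - m by lia | have -> : p = - n by lia]; try ring.
Qed.

End AffineBracket.

(** * The subalgebra q, its character and the coinduced module *)

Section Parabolic.
Variables (C : numClosedFieldType) (k j2 : int).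
Implicit Types (a b : gen).

(* q is spanned by the generators acting on the lowest weight vector by scalars (the
   whole of k + r_+ for the trivial module, a Borel subalgebra otherwise), l by those of
   them that normalise the complement of q. *)
Definition inq a : bool :=
  match a with
  | Ep n => (0 < n) || (n == 0) && (j2 == 0) | Em n | Eh n => 0 <= n | _ => true
  end.

Definition inl a : bool :=
  match a with
  | Ep n | Em n => (n == 0) && (j2 == 0) | Eh n => n == 0 | _ => true
  end.

Definition chi a : C :=
  match a with
  | Eh n => if n == 0 then - j2%:~R else 0 | Ek => k%:~R | Ed => dval C k j2 | _ => 0
  end.

Lemma inq_br a b : inq a -> inq b -> all (fun p : C * gen => inq p.2) (br a b).
Proof.
case: a b => [m|m|m||] [n|n|n||] //=; rewrite /central; do ?[case: ifP => ? /=]; lia.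
Qed.

Lemma ninq_br a b :
  ~~ inq a -> ~~ inq b -> all (fun p : C * gen => ~~ inq p.2) (br a b).
Proof.
case: a b => [m|m|m||] [n|n|n||] //=; rewrite /central; do ?[case: ifP => ? /=]; lia.
Qed.

Lemma inl_inq a : inl a -> inq a.
Proof. case: a => [m|m|m||] //=; lia. Qed.

Lemma inl_br a b : inl a -> ~~ inq b -> all (fun p : C * gen => ~~ inq p.2) (br a b).
Proof.
case: a b => [m|m|m||] [n|n|n||] //=; rewrite /central; do ?[case: ifP => ? /=]; lia.
Qed.

(** A central term carries the mode as a factor, and non-negative modes with sum zero are zero. The
    bracket of $J^+_0$ and $J^-_0$ lies in this range only for [j2 = 0], where [chi] vanishes on
    $J^0_0$. *)
Lemma chi_br a b : inq a -> inq b -> ev chi (br a b) = 0.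
Proof.
case: a b => [m|m|m||] [n|n|n||] //= qa qb; rewrite ?evE /=; try ring;
  case: eqP => e /=; try ring;
  first [have -> : m = 0 by lia | have -> : n = 0 by lia];
  first [ring | (have -> : j2 = 0 by lia); ring].
Qed.

Definition lw (M : ghat_data C) (x : gcar M) :=
  forall a, inq a -> act M a x = chi a *: x.

(** The first clause says that [f] descends from words to the enveloping algebra. The other two
    concern left multiplication, hence are preserved by the action [rapp] through right
    multiplication. *)
Definition coinduced (f : seq gen -> C^o) :=
  (forall y a b z, f (y ++ a :: b :: z) - f (y ++ b :: a :: z)
                   = ev (fun x => f (y ++ x :: z)) (br a b)) /\
  (forall a y, ~~ inq a -> f (a :: y) = 0) /\
  (forall a y, inl a -> f (a :: y) = chi a * f y).

Lemma coinduced_subspace : subspace coinduced.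
Proof.
split=> [|c f g [fr [fn fl]] [gr [gn gl]]].
  split=> [y a b z|]; first by rewrite subrr -[LHS](ev0 (br a b)).
  by split=> [a y _ //|a y _]; rewrite mulr0.
have E y : (c *: f + g) y = c * f y + g y by [].
split=> [y a b z|].
  rewrite !E (@eq_ev _ _ _ (fun x => c * f (y ++ x :: z) + g (y ++ x :: z))) //.
  by rewrite evD evZ -fr -gr; ring.
split=> [a y na|a y la]; first by rewrite E fn // gn // mulr0 addr0.
by rewrite !E fl // gl //; ring.
Qed.

Definition rapp a (f : seq gen -> C^o) : seq gen -> C^o := fun y => f (rcons y a).

Lemma rapp_lin a : lin (rapp a). Proof. by []. Qed.

Lemma rapp_coinduced a f : coinduced f -> coinduced (rapp a f).
Proof.
case=> fr [fn fl]; split=> [y b c z|]; last by split=> b y bq; [exact: fn | exact: fl].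
by rewrite /rapp !rcons_cat /= fr; apply: eq_ev => x; rewrite rcons_cat.
Qed.

Lemma evm_fct (psi : gen -> seq gen -> C^o) s y :
  evm psi s y = ev (fun x => psi x y) s.
Proof.
elim: s => [|p s IH]; first by rewrite evm_nil ev_nil.
by rewrite evm_cons ev_cons -IH.
Qed.

Lemma rapp_comm a b f : coinduced f ->
  rapp a (rapp b f) - rapp b (rapp a f) = evm (fun x => rapp x f) (br a b).
Proof.
case=> fr _; apply/funext => y; rewrite evm_fct.
rewrite (@eq_ev _ _ _ (fun x => f (y ++ [:: x]))) -?fr.
  by rewrite -![y ++ _ :: _ :: _]cat_rcons !cats1.
by move=> x; rewrite /rapp cats1.
Qed.

Definition coind : ghat_data C := sub_rep coinduced_subspace rapp_coinduced.

(** The vector is [vac] itself and [u] is evaluation at the empty word, so [u x = 1] shows that the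
    vector is non-zero. *)
Lemma coind_lw : exists (M : ghat_data C) (x : gcar M) (u : gcar M -> C),
  [/\ grep M, lw x, lin_form u & u x = 1] /\
  (forall a f, ~~ inq a -> u (act M a f) = 0) /\
  (forall a f, inl a -> u (act M a f) = chi a * u f).
Proof.
pose om := vac (@br C) inq chi.
have omP : coinduced om.
  split=> [y a b z|].
    exact: (vac_swap (@br_antisym C) (@br_jacobi C) inq_br ninq_br chi_br).
  split=> [a y /negbTE na|a y la]; first by rewrite /om vac_cons na.
  exact: (vac_lcons (@br_jacobi C) inq_br chi_br inl_inq inl_br).
exists coind, (smk coinduced_subspace omP), (fun f => smval f [::]); split; last first.
  split=> a f aq; rewrite smval_act /rapp /=; have [_ [fn fl]] := smP f.
    exact: fn.
  exact: fl.
split=> //; first by apply: sub_rep_grep; [exact: rapp_lin | exact: rapp_comm].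
move=> a qa; apply: smval_inj; rewrite smval_act /=.
apply/funext => y; rewrite /rapp /=.
exact: (vac_rcons (@br_antisym C) (@br_jacobi C) inq_br ninq_br chi_br).
Qed.

End Parabolic.
Arguments lw {C} k j2 M x.
Arguments chi {C} k j2 a.

(** * The dual module and the Chevalley involution *)

Section Dual.
Variables (C : numClosedFieldType) (W : ghat_data C).
Hypothesis repW : grep W.

Definition gopp (x : gen) : gen :=
  match x with
  | Ep n => Ep (- n) | Em n => Em (- n) | Eh n => Eh (- n) | Ek => Ek | Ed => Ed
  end.

Definition gsign (x : gen) : C :=
  match x with Ek | Ed => 1 | _ => -1 end.

(** [gopp] with the sign [gsign] is the anti-automorphism that defines the contragredient action. *)
Lemma gopp_br (phi : gen -> C) x y :
  gsign x * gsign y * ev phi (br (gopp y) (gopp x))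
  = ev (fun z => gsign z * phi (gopp z)) (br x y).
Proof.
case: x y => [m|m|m||] [n|n|n||] /=;
  rewrite ?evE /= -?opprD ?oppr_eq0 ?[n + m]addrC; try ring;
  case: eqP => [e|_] /=; try ring;
  by (have -> : n = - m by lia); ring.
Qed.

Definition gdual (x : gen) (phi : gcar W -> C^o) : gcar W -> C^o :=
  fun v => gsign x * phi (act W (gopp x) v).

Lemma gdual_lin x : lin (gdual x).
Proof.
move=> a phi psi; apply/funext => v; rewrite /gdual /=.
have E (u : gcar W) : (a *: phi + psi) u = a * phi u + psi u by [].
have E' (f g : gcar W -> C^o) : (a *: f + g) v = a * f v + g v by [].
by rewrite E E'; ring.
Qed.

Lemma lin_form_subspace : subspace (fun phi : gcar W -> C^o => lin_form phi).
Proof.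
split=> [c u v|c phi psi lphi lpsi d u v]; first by rewrite [RHS]addr0 mulr0.
have E (w : gcar W) : (c *: phi + psi) w = c * phi w + psi w by [].
by rewrite !E lphi lpsi; ring.
Qed.

Lemma gdual_lin_form x (phi : gcar W -> C^o) : lin_form phi -> lin_form (gdual x phi).
Proof.
by move=> lphi a u v; rewrite /gdual repW.1 lphi; ring.
Qed.

Lemma lin_form_evm (phi : gcar W -> C) (psi : gen -> gcar W) s : lin_form phi ->
  phi (evm psi s) = ev (fun x => phi (psi x)) s.
Proof.
move=> lphi; elim: s => [|p s IH]; first by rewrite evm_nil ev_nil lin_form0.
by rewrite evm_cons ev_cons lphi IH.
Qed.

Lemma gdual_comm x y (phi : gcar W -> C^o) : lin_form phi ->
  gdual x (gdual y phi) - gdual y (gdual x phi) = evm (fun z => gdual z phi) (br x y).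
Proof.
move=> lphi; apply/funext => v.
have -> : evm (fun z => gdual z phi) (br x y) v = ev (fun z => gdual z phi v) (br x y).
  elim: (br x y) => [|p s IH]; first by rewrite evm_nil ev_nil.
  by rewrite evm_cons ev_cons -IH.
rewrite -(gopp_br (fun z => phi (act W z v))) -lin_form_evm // -repW.2.
have := lphi (-1) (act W (gopp x) (act W (gopp y) v)) (act W (gopp y) (act W (gopp x) v)).
rewrite scaleN1r addrC => ->.
have E (f g : gcar W -> C^o) : (f - g) v = f v - g v by [].
by rewrite E /gdual; ring.
Qed.

(** The full dual, with no restriction on weights: it serves as a target for maps, and finiteness of
    supports is checked only for the resulting pairing. *)
Definition dual : ghat_data C := sub_rep lin_form_subspace gdual_lin_form.

Lemma dual_grep : grep dual.
Proof. by apply: sub_rep_grep; [exact: gdual_lin | exact: gdual_comm]. Qed.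

End Dual.

Definition chev (C : numClosedFieldType) (M : ghat_data C) : ghat_data C :=
  @GData C (gcar M) (Jm M) (Jp M) (fun n v => - J0 M n v) (Kop M) (dop M).

Section Chevalley.
Variable C : numClosedFieldType.
Implicit Types M N : ghat_data C.

Lemma chev_rep M : is_rep M -> is_rep (chev M).
Proof.
move=> [lp [lm [lh [lk [ld [pm [hp [hm [hh [pp [mm [dp [dm [dh [kp [km [kh kd]]]]]]]]]]]]]]]]].
have hN := fun n v => linN (lh n) v.
do 2!split=> //; split=> /= [n a u v|]; first by rewrite lh opprD scalerN.
do 2!split=> //.
split=> [m n v|].
  rewrite -opprB pm opprD [n + m]addrC; congr (_ + _).
  rewrite /delta0; case: eqP => e; last by rewrite oppr0.
  by rewrite -scaleNr -mulrNz; congr (_%:~R *: _); lia.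
split=> [m n v|]; first by rewrite (linN (lm n)) -opprD hm opprK.
split=> [m n v|]; first by rewrite (linN (lp n)) -opprD hp.
split=> [m n v|]; first by rewrite !hN !opprK hh.
do 4!split=> //; split; first by move=> n v; rewrite (linN ld) -opprD dh scalerN.
by do 2!split=> //; split=> // n v; rewrite (linN lk) kh.
Qed.

Lemma chev_grep M : grep M -> grep (chev M).
Proof. by move=> /is_rep_grep /chev_rep /is_rep_grep. Qed.

Lemma gmap_chev M N (f : gcar M -> gcar N) : gmap (chev M) (chev N) f -> gmap M N f.
Proof.
case=> lf [fp [fm [fh [fk fd]]]]; do 3!split=> //.
by split=> // n v; have := fh n v; rewrite /= (linN lf) => /oppr_inj.
Qed.

Lemma gmap_chevl M N (f : gcar M -> gcar N) : gmap M (chev N) f -> gmap (chev M) N f.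
Proof.
case=> lf [fp [fm [fh [fk fd]]]]; do 3!split=> //.
by split=> // n v; rewrite (linN lf) fh opprK.
Qed.

Lemma gmap_chevr M N (f : gcar M -> gcar N) : gmap (chev M) N f -> gmap M (chev N) f.
Proof.
case=> lf [fp [fm [fh [fk fd]]]]; do 3!split=> //.
by split=> // n v; rewrite /= -fh /= (linN lf) opprK.
Qed.

Lemma pcommon_chev k dv M (x : gcar M) : pcommon k dv x -> @pcommon C k dv (chev M) x.
Proof.
case=> kx [dx nx]; do 2!split=> //; move=> n n0.
by have [px [mx hx]] := nx _ n0; do 2!split=> //=; rewrite hx oppr0.
Qed.

Lemma pmap_plus_chev k j2 M (u : nat -> gcar M) :
  pmap_plus k j2 u -> @pmap_minus C k j2 (chev M) u.
Proof.
move=> pu m; have [pc [hx [px mx]]] := pu m; split; first exact: pcommon_chev.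
by split=> //=; rewrite hx -scaleNr -mulrN opprB.
Qed.

Lemma pmap_minus_chev k j2 M (u : nat -> gcar M) :
  pmap_minus k j2 u -> @pmap_plus C k j2 (chev M) u.
Proof.
move=> pu m; have [pc [hx [px mx]]] := pu m; split; first exact: pcommon_chev.
by split=> //=; rewrite hx -scaleNr -mulrN opprB.
Qed.

Lemma prolong_minus_chev k j2 W w :
  is_prolong_minus k j2 W w -> @is_prolong_plus C k j2 (chev W) w.
Proof.
case=> rW [pw univ]; split; first exact: chev_rep.
split=> [|M u rM pu]; first exact: pmap_minus_chev.
have [f [mf [fw fu]]] := univ (chev M) u (chev_rep rM) (pmap_plus_chev pu).
exists f; split; first exact: gmap_chevl.
by split=> // g mg gw; apply: fu => //; exact: gmap_chevr.
Qed.

Lemma pmap_triv_chev k M (u : gcar M) : pmap_triv k u -> @pmap_triv C k (chev M) u.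
Proof.
move=> [pc [px [mx hx]]]; split; first exact: pcommon_chev.
by do 2!split=> //=; rewrite hx oppr0.
Qed.

Lemma prolong_triv_chev k W w : is_prolong_triv k W w -> @is_prolong_triv C k (chev W) w.
Proof.
case=> rW [pw univ]; split; first exact: chev_rep.
split=> [|M u rM pu]; first exact: pmap_triv_chev.
have [f [mf [fw fu]]] := univ (chev M) u (chev_rep rM) (pmap_triv_chev pu).
exists f; split; first exact: gmap_chevl.
by split=> // g mg gw; apply: fu => //; exact: gmap_chevr.
Qed.

End Chevalley.

(** * Prolongations as universal lowest weight modules *)

Definition gm (C : numClosedFieldType) (M N : ghat_data C) (f : gcar M -> gcar N) :=
  lin f /\ forall x v, f (act M x v) = act N x (f v).

(** One vector replaces the whole basis of $D^+_j$. The value [j2 = 0] covers the trivial module, so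
    that both kinds of prolongation are treated at once. *)
Definition universal (C : numClosedFieldType) (k j2 : int) (W : ghat_data C) (w : gcar W) :=
  [/\ grep W, lw k j2 W w &
  forall (M : ghat_data C) (x : gcar M), grep M -> lw k j2 M x ->
    exists f, gm f /\ f w = x /\ forall g : gcar W -> gcar M, gm g -> g w = x -> g =1 f].
Arguments universal {C} k j2 W w.

Section Universal.
Variable C : numClosedFieldType.
Implicit Types (M W : ghat_data C).

Lemma lwP k j2 M (x : gcar M) : lw k j2 M x <->
  [/\ pcommon k (dval C k j2) x, J0 M 0 x = - j2%:~R *: x, Jm M 0 x = 0
    & j2 = 0 -> Jp M 0 x = 0].
Proof.
split=> [lx|[[kx [dx nx]] hx mx px]].
  split; [|exact: (lx (Eh 0) (lexx _))| |].
  - split; [exact: (lx Ek isT)|split; [exact: (lx Ed isT)|move=> n n0]].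
    have n00 : n != 0 by lia.
    split; first by have := lx (Ep n); rewrite /= n0 scale0r; apply.
    split; first by have := lx (Em n); rewrite /= ltW // scale0r; apply.
    by have := lx (Eh n); rewrite /= ltW // (negbTE n00) scale0r; apply.
  - by have := lx (Em 0); rewrite /= scale0r; apply.
  - by move=> j0; have := lx (Ep 0); rewrite /= j0 scale0r; apply.
case=> [n|n|n||] //= qn; rewrite ?scale0r.
- have [n0|n0] := ltrP 0 n; first by have [] := nx n n0.
  have [-> j0] : n = 0 /\ j2 = 0 by lia.
  exact: px.
- have [n0|n0] := ltrP 0 n; first by have [_ []] := nx n n0.
  by have -> : n = 0 by lia.
- have [->|n0] := eqVneq n 0 => //.
  have /nx[_ [_ ->]] : 0 < n by lia.
  by rewrite scale0r.
Qed.

Lemma prolong_triv_universal k W w : is_prolong_triv k W w -> universal k 0 W w.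
Proof.
have D0 : dval C k 0 = 0 by rewrite /dval /jC; ring.
have E M (x : gcar M) : lw k 0 M x <-> pmap_triv k x.
  rewrite lwP D0 /pmap_triv; split.
    by case=> pc; rewrite oppr0 scale0r => hx mx px; split=> //; split=> //; exact: px.
  by case=> pc [px [mx hx]]; split=> //; rewrite hx oppr0 scale0r.
case=> rW [pw univ]; split; [exact/is_rep_grep|exact/E|].
move=> M x /is_rep_grep rM /E px; have [f [/gmap_act mf [fw fu]]] := univ M x rM px.
by exists f; split=> //; split=> // g /gmap_act mg gw; apply: fu.
Qed.

Lemma sqrt_neq0 (j2 : int) (m : nat) : j2 < 0 -> sqrtC (m.+1%:R * (m%:R - j2%:~R)) != 0 :> C.
Proof.
move=> j0; rewrite sqrtC_eq0 mulf_neq0 ?pnatr_eq0 //.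
have -> : m%:R - j2%:~R = (m%:Z - j2)%:~R :> C by rewrite intrB.
by rewrite intr_eq0; lia.
Qed.

(** The factor that rescales $(J^+_0)^m x$ to the image of $|j,m\rangle_+$. *)
Fixpoint coefs (j2 : int) (m : nat) : C :=
  if m is m'.+1 then coefs j2 m' / sqrtC (m'.+1%:R * (m'%:R - j2%:~R)) else 1.

(** $J^+_0$ commutes with [K] and [d] and normalises $\mathfrak{r}_+$, so [pcommon] spreads along
    its powers; the action of $J^-_0$ follows inductively from $[J^+_0,J^-_0]=J^0_0$. *)
Lemma lw_pmap_plus (k j2 : int) M (x : gcar M) : j2 < 0 -> grep M -> lw k j2 M x ->
  pmap_plus k j2 (fun m => coefs j2 m *: iter m (Jp M 0) x).
Proof.
move=> j0 /is_rep_grep rM /lwP[pc hx mx _].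
case: rM => [lp [lm [lh [lk [ld [pm [hp [hm [hh [pp [mm [dp [dm [dh [kp [km [kh kd]]]]]]]]]]]]]]]]].
set y := fun m => iter m (Jp M 0) x.
have y1 m : Jp M 0 (y m) = y m.+1 by [].
have yh m : J0 M 0 (y m) = (2 * (m%:R - jC C j2)) *: y m.
  elim: m => [|m IH]; first by rewrite hx /jC; congr (_ *: _); field.
  rewrite -y1; have := hp 0 0 (y m); rewrite add0r IH => /eqP; rewrite subr_eq => /eqP ->.
  by rewrite (linZ (lp 0)) -scalerDl; congr (_ *: _); rewrite -natr1; ring.
have yc m : pcommon k (dval C k j2) (y m).
  elim: m => // m [IHk [IHd IHn]]; rewrite -y1; split; first by rewrite kp IHk (linZ (lp 0)).
  split.
    have := dp 0 (y m); rewrite scale0r => /eqP; rewrite subr_eq0 => /eqP ->.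
    by rewrite IHd (linZ (lp 0)).
  move=> n n0; have [px' [mx' hx']] := IHn n n0.
  split; first by rewrite pp px' (lin0 (lp 0)).
  split.
    have := pm 0 n (y m); rewrite add0r mx' (lin0 (lp 0)) sub0r hx' add0r.
    rewrite /delta0 gt_eqF // => /eqP; rewrite oppr_eq0 => /eqP //.
  have := hp n 0 (y m); rewrite addr0 hx' px' (lin0 (lp 0)) subr0 scaler0 //.
have ym m : Jm M 0 (y m.+1) = - ((m.+1%:R * (m%:R - j2%:~R)) *: y m).
  elim: m => [|m IH].
    have := pm 0 0 x; rewrite addr0 /delta0 eqxx scale0r addr0 mx (lin0 (lp 0)) sub0r hx.
    by rewrite mul1r sub0r => <-; rewrite opprK.
  have := pm 0 0 (y m.+1); rewrite addr0 /delta0 eqxx scale0r addr0 IH y1 yh.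
  rewrite (linN (lp 0)) (linZ (lp 0)) y1 => e.
  have -> : Jm M 0 (y m.+2) = - ((m.+1%:R * (m%:R - j2%:~R)) *: y m.+1)
      - (2 * (m.+1%:R - jC C j2)) *: y m.+1 by rewrite -e opprB addrC subrK.
  rewrite -opprD -scalerDl; congr (- (_ *: _)).
  by rewrite /jC -[m.+2%:R]natr1 -[m.+1%:R]natr1; field.
have pcZ c m : pcommon k (dval C k j2) (c *: y m).
  have [yk [yd yn]] := yc m; split; first by rewrite (linZ lk) yk !scalerA mulrC.
  split; first by rewrite (linZ ld) yd !scalerA mulrC.
  move=> n /yn[p' [m' h']].
  by rewrite (linZ (lp n)) (linZ (lm n)) (linZ (lh n)) p' m' h' scaler0.
move=> m; split; first exact: pcZ.
split; first by rewrite (linZ (lh 0)) yh !scalerA mulrC.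
split.
  by rewrite (linZ (lp 0)) scalerA /= mulrC divfK // sqrt_neq0.
rewrite (linZ (lm 0)); case: m => [|m].
  by rewrite mul0r sqrtC0 !scale0r mx scaler0 oppr0.
rewrite ym -natr1 addrK scalerN scalerA natr1 scalerA /=; congr (- (_ *: _)).
(* The factor produced by $J^-_0$ is the square of the root by which consecutive [coefs] differ. *)
set s := sqrtC _; rewrite -[_ * (_ - _)]sqrtCK -/s.
have s0 : s != 0 by exact: sqrt_neq0.
by rewrite expr2; field.
Qed.

(** For [j2 < 0] the coefficients of $J^+_0$ are non-zero, so a module map is determined on all
    [w m] by its value at [w 0]. *)
Lemma prolong_plus_universal (k j2 : int) W w : j2 < 0 ->
  is_prolong_plus k j2 W w -> universal k j2 W (w 0%N).
Proof.
move=> j0 [rW [pw univ]]; split; first exact/is_rep_grep.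
  apply/lwP; have [pc [hx [px mx]]] := pw 0%N; split=> //.
  - by rewrite hx; congr (_ *: _); rewrite /jC; field.
  - by rewrite mx mul0r sqrtC0 scale0r oppr0.
  - by move=> e; rewrite e in j0.
move=> M x rM lx; have px := lw_pmap_plus j0 rM lx.
have [f [/gmap_act mf [fw fu]]] := univ M _ (proj2 (is_rep_grep M) rM) px.
exists f; split=> //; split; first by rewrite fw /= scale1r.
move=> g mg gw v; apply: fu; first exact/gmap_act.
elim=> [|m IH]; first by rewrite gw /= scale1r.
have [_ [_ [pwm _]]] := pw m; have [_ [_ [pum _]]] := px m.
have e : act M (Ep 0) (g (w m)) = g (act W (Ep 0) (w m)) by rewrite mg.2.
move: e; rewrite /= pwm IH pum (linZ mg.1) => /(scalerI (sqrt_neq0 m j0)) <-.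
by [].
Qed.

Lemma universal_chev2 k j2 W w : universal k j2 W w -> universal k j2 (chev (chev W)) w.
Proof.
case: W w => V jp jm jh jk jd /= w.
rewrite /chev /=; have -> // : (fun n v => - - jh n v) = jh.
by apply/funext => n; apply/funext => v; rewrite opprK.
Qed.

(** Universality gives a map from [W] to the submodule [P]; followed by the inclusion it fixes [w],
    hence is the identity by uniqueness. *)
Lemma universal_gen k j2 W w (P : gcar W -> Prop) : universal k j2 W w -> subspace P ->
  (forall x v, P v -> P (act W x v)) -> P w -> forall v, P v.
Proof.
case=> rW lww univ sP Pact Pw v.
pose S := sub_rep sP Pact.
have rS : grep S.
  by apply: sub_rep_grep; [exact: rW.1 | move=> x y u _; exact: rW.2].
have lS : lw k j2 S (smk sP Pw).
  by move=> a qa; apply: smval_inj; rewrite smval_act lww.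
have [f [[lf fa] [fw _]]] := univ S _ rS lS.
have [i [_ [_ iu]]] := univ W w rW lww.
have e1 : smval (f v) = i v.
  apply: (iu (fun u => smval (f u))); last by rewrite fw.
  by split=> [a u u'|x u]; rewrite ?lf ?smval_lin // fa smval_act.
have e2 : v = i v by apply: (iu id).
by rewrite e2 -e1; exact: smP.
Qed.

End Universal.

(** * Linear identities in modules *)

Section LinearExpressions.
Variables (C : numClosedFieldType) (V : lmodType C).

Inductive lexp := LAtom of nat | LAdd of lexp & lexp | LOpp of lexp
  | LScale of C & lexp | LZero.

Fixpoint leval (env : seq V) e : V :=
  match e with
  | LAtom n => nth 0 env n
  | LAdd e1 e2 => leval env e1 + leval env e2
  | LOpp e1 => - leval env e1
  | LScale c e1 => c *: leval env e1
  | LZero => 0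
  end.

Fixpoint lcoef e (i : nat) : C :=
  match e with
  | LAtom n => if n == i then 1 else 0
  | LAdd e1 e2 => lcoef e1 i + lcoef e2 i
  | LOpp e1 => - lcoef e1 i
  | LScale c e1 => c * lcoef e1 i
  | LZero => 0
  end.

Fixpoint same_coefs e1 e2 n : Prop :=
  if n is m.+1 then lcoef e1 m = lcoef e2 m /\ same_coefs e1 e2 m else True.

Lemma levalE env e : leval env e = \sum_(i < size env) lcoef e i *: nth 0 env i.
Proof.
elim: e => [n|e1 IH1 e2 IH2|e1 IH1|c e1 IH1|] /=.
- have [ln|ln] := ltnP n (size env).
    rewrite (bigD1 (Ordinal ln)) //= eqxx scale1r big1 ?addr0 // => i ni.
    by case: eqP => [e|_]; rewrite ?scale0r //; case/eqP: ni; apply: val_inj.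
  rewrite nth_default // big1 // => i _; case: eqP => [e|_]; rewrite ?scale0r //.
  by have := ltn_ord i; rewrite -e ltnNge ln.
- by rewrite IH1 IH2 -big_split; apply: eq_bigr => i _; rewrite scalerDl.
- by rewrite IH1 -sumrN; apply: eq_bigr => i _; rewrite scaleNr.
- by rewrite IH1 scaler_sumr; apply: eq_bigr => i _; rewrite scalerA.
- by rewrite big1 // => i _; rewrite scale0r.
Qed.

Lemma leval_eq env e1 e2 :
  same_coefs e1 e2 (size env) -> leval env e1 = leval env e2.
Proof.
move=> s; rewrite !levalE; apply: eq_bigr => i _; congr (_ *: _).
elim: (size env) (i : nat) (ltn_ord i) s => // n IH m; rewrite ltnS leq_eqVlt.
by case/predU1P => [->|ltn] /= [] // _; apply: IH.
Qed.

End LinearExpressions.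

(** The dummy matches on [Set] run [unify] while a term is being built and let a failure fall
    through to the next branch. *)
Ltac lfind a l :=
  lazymatch l with
  | cons ?b ?l' =>
      match constr:(Set) with
      | _ => let _ := match constr:(Set) with _ => unify a b end in constr:(O)
      | _ => let n := lfind a l' in constr:(S n)
      end
  end.
Ltac linsert a l :=
  match constr:(Set) with
  | _ => let _ := lfind a l in l
  | _ => constr:(cons a l)
  end.
Ltac latoms t l :=
  lazymatch t with
  | (?u + ?v)%R => let l1 := latoms u l in latoms v l1
  | (- ?u)%R => latoms u l
  | (_ *: ?u)%R => latoms u l
  | 0%R => l
  | _ => linsert t l
  end.
Ltac lreify C t l :=
  lazymatch t with
  | (?u + ?v)%R =>
      let e1 := lreify C u l in let e2 := lreify C v l in constr:(@LAdd C e1 e2)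
  | (- ?u)%R => let e1 := lreify C u l in constr:(@LOpp C e1)
  | (?c *: ?u)%R => let e1 := lreify C u l in constr:(@LScale C c e1)
  | 0%R => constr:(@LZero C)
  | _ => let n := lfind t l in constr:(@LAtom C n)
  end.
(* Proves an equality of linear combinations of atoms in a module over C by comparing
   the coefficients of each atom. *)
Ltac lmodule C :=
  lazymatch goal with
  | |- @eq ?T ?u ?v =>
      let l0 := latoms u (@nil T) in let l := latoms v l0 in
      let e1 := lreify C u l in let e2 := lreify C v l in
      refine (@leval_eq C _ l e1 e2 _); rewrite /=; repeat split; try by [ring | field]
  end.

(** * The Sugawara operator *)

Section Commutators.
Variables (C : numClosedFieldType) (W : ghat_data C).
Hypothesis repW : grep W.
Implicit Types (m n : int) (v : gcar W).

Lemma swap_act (x y : gen) v :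
  act W x (act W y v) = act W y (act W x v) + evm (fun z => act W z v) (br x y).
Proof. by rewrite -repW.2 addrC subrK. Qed.

Lemma swap_pm m n v : Jp W m (Jm W n v) =
  Jm W n (Jp W m v) + J0 W (m + n) v + delta0 (m + n) (m%:~R *: Kop W v).
Proof. by have := swap_act (Ep m) (Em n) v; rewrite /= !evmE /= scale1r addrA. Qed.

Lemma swap_mp m n v : Jm W m (Jp W n v) =
  Jp W n (Jm W m v) - J0 W (m + n) v + delta0 (m + n) (m%:~R *: Kop W v).
Proof. by have := swap_act (Em m) (Ep n) v; rewrite /= !evmE /= scaleN1r addrA. Qed.

Lemma swap_hp m n v : J0 W m (Jp W n v) = Jp W n (J0 W m v) + 2 *: Jp W (m + n) v.
Proof. by have := swap_act (Eh m) (Ep n) v; rewrite /= !evmE /= addr0. Qed.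

Lemma swap_hm m n v : J0 W m (Jm W n v) = Jm W n (J0 W m v) - 2 *: Jm W (m + n) v.
Proof. by have := swap_act (Eh m) (Em n) v; rewrite /= !evmE /= addr0 scaleNr. Qed.

Lemma swap_mh m n v : Jm W m (J0 W n v) = J0 W n (Jm W m v) + 2 *: Jm W (m + n) v.
Proof. by have := swap_act (Em m) (Eh n) v; rewrite /= !evmE /= addr0. Qed.

Lemma swap_pp m n v : Jp W m (Jp W n v) = Jp W n (Jp W m v).
Proof. by have := swap_act (Ep m) (Ep n) v; rewrite /= !evmE addr0. Qed.

Lemma swap_mm m n v : Jm W m (Jm W n v) = Jm W n (Jm W m v).
Proof. by have := swap_act (Em m) (Em n) v; rewrite /= !evmE addr0. Qed.

Lemma swap_dp n v : dop W (Jp W n v) = Jp W n (dop W v) + n%:~R *: Jp W n v.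
Proof. by have := swap_act Ed (Ep n) v; rewrite /= !evmE /= addr0. Qed.

Lemma swap_dm n v : dop W (Jm W n v) = Jm W n (dop W v) + n%:~R *: Jm W n v.
Proof. by have := swap_act Ed (Em n) v; rewrite /= !evmE /= addr0. Qed.

Lemma swap_dh n v : dop W (J0 W n v) = J0 W n (dop W v) + n%:~R *: J0 W n v.
Proof. by have := swap_act Ed (Eh n) v; rewrite /= !evmE /= addr0. Qed.

Lemma linp n : lin (Jp W n). Proof. exact: (repW.1 (Ep n)). Qed.
Lemma linm n : lin (Jm W n). Proof. exact: (repW.1 (Em n)). Qed.
Lemma linh n : lin (J0 W n). Proof. exact: (repW.1 (Eh n)). Qed.
Lemma link : lin (Kop W). Proof. exact: (repW.1 Ek). Qed.
Lemma lind : lin (dop W). Proof. exact: (repW.1 Ed). Qed.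

Definition linpE := (fun n => linD (linp n), fun n => linB (linp n), fun n => linN (linp n),
  fun n => linZ (linp n), fun n => lin0 (linp n)).
Definition linmE := (fun n => linD (linm n), fun n => linB (linm n), fun n => linN (linm n),
  fun n => linZ (linm n), fun n => lin0 (linm n)).
Definition linhE := (fun n => linD (linh n), fun n => linB (linh n), fun n => linN (linh n),
  fun n => linZ (linh n), fun n => lin0 (linh n)).

(* The i-th summand of the Sugawara operator, and the boundary term that telescopes. *)
Definition cas (i : int) v : gcar W :=
  Jp W (- i) (Jm W i v) + Jm W (- i) (Jp W i v) + 2^-1 *: J0 W (- i) (J0 W i v).

Definition casb (i : int) v : gcar W :=
  J0 W (- i - 1) (Jm W i v) - Jm W (- i - 1) (J0 W i v).

Lemma delta0_0 n v : n != 0 -> delta0 n v = 0.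
Proof. by rewrite /delta0 => /negbTE ->. Qed.

(** The summand is the invariant tensor of sl2 placed in modes [-i] and [i], so it commutes with
    zero modes. The central term has the factor [i] and could occur only at [i = 0]. *)
Lemma cas_p0 i v : cas i (Jp W 0 v) = Jp W 0 (cas i v).
Proof.
have e : delta0 i (i%:~R *: Kop W v) = 0.
  by rewrite /delta0; case: eqP => // ->; rewrite scale0r.
have e' u : delta0 (- i) ((- i)%:~R *: Kop W u) = 0.
  by rewrite /delta0; case: eqP => // ->; rewrite scale0r.
rewrite /cas swap_mp swap_hp [Jp W i _]swap_pp !addr0 e addr0 !linpE !linhE.
rewrite swap_mp [J0 W _ (Jp W 0 _)]swap_hp !addr0 e' addr0 [Jp W (-i) (Jp W 0 _)]swap_pp.
lmodule C.
Qed.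

(** Bracketing with $J^-_{-1}$ shifts one of the two modes, which leaves a difference of consecutive
    boundary terms; the level enters only when [i] meets the mode [-1]. *)
Lemma cas_m1 (c : C) (i : int) v : Kop W v = c *: v -> 1 <= i ->
  cas i (Jm W (-1) v) =
  Jm W (-1) (cas i v) + casb i v - casb (i - 1) v + (i == 1)%:R * c *: Jm W (-1) v.
Proof.
move=> Kv i1; rewrite /cas /casb.
have e : delta0 (i - 1) (i%:~R *: Kop W v) = ((i == 1)%:R * c) *: v.
  rewrite /delta0 subr_eq0; case: eqP => [->|_]; last by rewrite mul0r scale0r.
  by rewrite Kv scale1r mul1r.
have e' u : delta0 (- i - 1) ((- i)%:~R *: Kop W u) = 0.
  by rewrite delta0_0 //; lia.
rewrite [Jp W i (Jm W _ _)]swap_pm [J0 W i (Jm W _ _)]swap_hm e.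
rewrite [Jm W i (Jm W _ _)]swap_mm !linmE // !linhE //.
rewrite [Jp W _ (Jm W (-1) _)]swap_pm [J0 W _ (Jm W (-1) _)]swap_hm e' addr0.
rewrite [Jm W (-i) (Jm W (-1) _)]swap_mm.
have -> : - (i - 1) - 1 = - i by lia.
case: eqP => [->|_]; lmodule C.
Qed.

Lemma cas0_m1 v : cas 0 (Jm W (-1) v) =
  Jm W (-1) (cas 0 v) + 2 *: casb 0 v + 4 *: Jm W (-1) v.
Proof.
rewrite /cas /casb oppr0 sub0r.
have e u : delta0 (0 - 1) (0%:~R *: Kop W u) = 0 by rewrite delta0_0.
rewrite [Jp W 0 (Jm W (-1) _)]swap_pm [J0 W 0 (Jm W (-1) _)]swap_hm e addr0.
rewrite [Jm W 0 (Jm W (-1) _)]swap_mm !linmE // !linhE // sub0r.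
rewrite [Jp W _ (Jm W (-1) _)]swap_pm [J0 W _ (Jm W (-1) _)]swap_hm e addr0 !sub0r.
rewrite [Jm W 0 (Jm W (-1) _)]swap_mm [Jm W 0 (J0 W _ _)]swap_mh sub0r.
rewrite [J0 W 0 (Jm W (-1) v)]swap_hm sub0r.
lmodule C.
Qed.

(** Truncating at [N] avoids an infinite sum; only large [N] matter. *)
Definition Cas (c : C) (N : nat) v : gcar W :=
  (2 * (c + 2)) *: dop W v + cas 0 v + 2 *: \sum_(i < N) cas i.+1%:Z v.

Lemma Cas_p0 c N v : Cas c N (Jp W 0 v) = Jp W 0 (Cas c N v).
Proof.
rewrite /Cas cas_p0 swap_dp scale0r addr0.
rewrite (eq_bigr (fun i : 'I_N => Jp W 0 (cas i.+1%:Z v))); last first.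
  by move=> i _; rewrite cas_p0.
have E a b x y z : Jp W 0 (a *: x + y + b *: z)
    = a *: Jp W 0 x + Jp W 0 y + b *: Jp W 0 z by rewrite !linpE.
by rewrite -(lin_sum (linp 0)) E.
Qed.

Lemma sum_cas_m1 c N v : Kop W v = c *: v ->
  \sum_(i < N.+1) cas i.+1%:Z (Jm W (-1) v) =
  Jm W (-1) (\sum_(i < N.+1) cas i.+1%:Z v) + casb N.+1%:Z v - casb 0 v
  + c *: Jm W (-1) v.
Proof.
move=> Kv; elim: N => [|N IH].
  by rewrite !big_ord1 (cas_m1 Kv) // mul1r subrr.
rewrite big_ord_recr IH [in RHS]big_ord_recr /= (cas_m1 Kv) //.
rewrite (linD (linm (-1)) (\sum_(i < N.+1) cas i.+1%:Z v)).
have -> : N.+2%:Z - 1 = N.+1%:Z by lia.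
have -> : (N.+2%:Z == 1) = false by lia.
lmodule C.
Qed.

(** The multiples of $J^-_{-1}v$ cancel: [d] contributes $-2(c+2)$, the zero mode summand 4, and the
    central term $2c$. The boundary terms telescope to the last one. *)
Lemma Cas_m1 c N v : Kop W v = c *: v ->
  Cas c N.+1 (Jm W (-1) v) = Jm W (-1) (Cas c N.+1 v) + 2 *: casb N.+1%:Z v.
Proof.
move=> Kv; rewrite /Cas (sum_cas_m1 _ Kv) cas0_m1 swap_dm.
have E a b x y z : Jm W (-1) (a *: x + y + b *: z)
    = a *: Jm W (-1) x + Jm W (-1) y + b *: Jm W (-1) z by rewrite !linmE.
rewrite E; lmodule C.
Qed.

End Commutators.

(** * Generation by two letters and vanishing of the Sugawara operator *)

Section Structure.
Variables (C : numClosedFieldType) (k j2 : int) (W : ghat_data C) (w : gcar W).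
Hypothesis univ : universal k j2 W w.
Implicit Types v : gcar W.

Let repW : grep W. Proof. by case: univ. Qed.
Let lww : lw k j2 W w. Proof. by case: univ. Qed.

(** The two letters generate the Lie algebra spanned by $J^+_n$ with $n\le0$ and $J^-_n$, $J^0_n$
    with $n<0$. *)
Inductive nspan : gcar W -> Prop :=
  | nspan_w : nspan w
  | nspan_lin a u v of nspan u & nspan v : nspan (a *: u + v)
  | nspan_p v of nspan v : nspan (Jp W 0 v)
  | nspan_m v of nspan v : nspan (Jm W (-1) v).

Lemma nspan_subspace : subspace nspan.
Proof.
split=> [|a u v]; last exact: nspan_lin.
by have := nspan_lin (-1) nspan_w nspan_w; rewrite scaleN1r addNr.
Qed.

(** Brackets with $J^+_0$ turn $J^-$ into $J^0$, and brackets with $J^0_{-1}$ lower modes by one.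
    The mode of $J^+$ lags by one because the process starts from $J^+_0$ and $J^-_{-1}$. *)
Lemma nspan_neg (i : nat) v : nspan v ->
  [/\ nspan (Jp W (- i%:Z) v), nspan (Jm W (- i.+1%:Z) v) & nspan (J0 W (- i.+1%:Z) v)].
Proof.
have sS := nspan_subspace.
have hE n u : J0 W (- n.+1%:Z) u = Jp W 0 (Jm W (- n.+1%:Z) u) - Jm W (- n.+1%:Z) (Jp W 0 u).
  rewrite swap_pm // add0r delta0_0 ?addr0; last by lia.
  by lmodule C.
have Sh n : (forall u, nspan u -> nspan (Jm W (- n.+1%:Z) u)) ->
    forall u, nspan u -> nspan (J0 W (- n.+1%:Z) u).
  move=> Sm u Su; rewrite hE; apply: (subspaceB sS).
    exact/nspan_p/Sm.
  exact/Sm/nspan_p.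
elim: i v => [|i IH] v Sv.
  by split; [exact: nspan_p | exact: nspan_m | apply: Sh Sv; exact: nspan_m].
have Sp u : nspan u -> nspan (Jp W (- i.+1%:Z) u).
  move=> Su; have -> : Jp W (- i.+1%:Z) u
      = 2^-1 *: (J0 W (-1) (Jp W (- i%:Z) u) - Jp W (- i%:Z) (J0 W (-1) u)).
    rewrite swap_hp //; have -> : -1 + - i%:Z = - i.+1%:Z by lia.
    by lmodule C.
  have S1 u' : nspan u' -> nspan (J0 W (-1) u') by apply: (Sh 0%N) => u0; exact: nspan_m.
  have Si u' : nspan u' -> nspan (Jp W (- i%:Z) u') by case/IH.
  by apply: (subspaceZ sS); apply: (subspaceB sS); [exact/S1/Si|exact/Si/S1].
have Sm u : nspan u -> nspan (Jm W (- i.+2%:Z) u).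
  move=> Su; have -> : Jm W (- i.+2%:Z) u
      = - 2^-1 *: (J0 W (-1) (Jm W (- i.+1%:Z) u) - Jm W (- i.+1%:Z) (J0 W (-1) u)).
    rewrite swap_hm //; have -> : -1 + - i.+1%:Z = - i.+2%:Z by lia.
    by lmodule C.
  have S1 u' : nspan u' -> nspan (J0 W (-1) u') by apply: (Sh 0%N) => u0; exact: nspan_m.
  have Si u' : nspan u' -> nspan (Jm W (- i.+1%:Z) u') by case/IH.
  by apply: (subspaceZ sS); apply: (subspaceB sS); [exact/S1/Si|exact/Si/S1].
by split; [exact: Sp | exact: Sm | exact: Sh].
Qed.

(** A letter is moved right through the two generators; the brackets that arise are covered because
    the induction hypothesis ranges over all letters. *)
Lemma nspan_act x v : nspan v -> nspan (act W x v).
Proof.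
have sS := nspan_subspace.
have N y : ~~ inq j2 y -> forall u, nspan u -> nspan (act W y u).
  case: y => [[n|n]|[n|n]|[n|n]||] //= nq u Su.
  - have -> : n%:Z = - 0%N%:Z by lia.
    by case: (nspan_neg 0 Su).
  - by rewrite NegzE; case: (nspan_neg n.+1 Su).
  - by rewrite NegzE; case: (nspan_neg n Su).
  - by rewrite NegzE; case: (nspan_neg n Su).
have S_evm (f : gen -> gcar W) s : (forall y, nspan (f y)) -> nspan (evm f s).
  by move=> Sf; apply: (subspace_sum sS) => p _; exact: (subspaceZ sS).
move=> Sv; elim: Sv x => [|a u u' _ IH _ IH'|u Su IH|u Su IH] x.
- case: (boolP (inq j2 x)) => [qx|nx]; last by apply: N => //; exact: nspan_w.
  by rewrite lww //; apply: (subspaceZ sS); exact: nspan_w.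
- by rewrite repW.1; apply: nspan_lin.
- rewrite (swap_act repW x (Ep 0)); apply: (subspaceD sS); first exact/nspan_p/IH.
  exact: S_evm.
- rewrite (swap_act repW x (Em (-1))); apply: (subspaceD sS); first exact/nspan_m/IH.
  exact: S_evm.
Qed.

(** By universality [nspan] is everything, so a linear property need only be checked at [w] and
    carried across two letters. *)
Lemma neg_gen (P : gcar W -> Prop) : subspace P -> P w ->
  (forall v, P v -> P (Jp W 0 v)) -> (forall v, P v -> P (Jm W (-1) v)) ->
  forall v, P v.
Proof.
move=> sP Pw Pp Pm v.
have : nspan v by apply: (universal_gen univ nspan_subspace nspan_act nspan_w).
by elim=> {v} // [a u v _ Pu _ Pv|v _ Pv|v _ Pv]; [exact: sP.2|exact: Pp|exact: Pm].
Qed.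

Lemma univ_K v : Kop W v = k%:~R *: v.
Proof.
move: v; apply: neg_gen => [||v e|v e].
- split=> [|a u v eu ev']; first by rewrite (lin0 (link repW)) scaler0.
  by rewrite (link repW) eu ev'; lmodule C.
- exact: (lww (a := Ek)).
- have := swap_act repW Ek (Ep 0) v; rewrite /= evm_nil addr0 e => ->.
  exact: (linZ (linp repW 0)).
- have := swap_act repW Ek (Em (-1)) v; rewrite /= evm_nil addr0 e => ->.
  exact: (linZ (linm repW (-1))).
Qed.

Lemma univ_smooth v : exists N : nat, forall n : int, N%:Z <= n ->
  [/\ Jp W n v = 0, Jm W n v = 0 & J0 W n v = 0].
Proof.
move: v; apply: neg_gen => [||v [N hN]|v [N hN]].
- split=> [|a u v [N hN] [N' hN']].
    by exists 0%N => n _; rewrite (lin0 (linp repW n)) (lin0 (linm repW n)) (lin0 (linh repW n)).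
  exists (N + N')%N => n ln.
  have /hN[p m h] : N%:Z <= n by lia.
  have /hN'[p' m' h'] : N'%:Z <= n by lia.
  by rewrite (linp repW n) (linm repW n) (linh repW n) p m h p' m' h' scaler0 addr0.
- have /lwP[[_ [_ nw]] _ _ _] := lww.
  by exists 1%N => n n1; have /nw[? []] : 0 < n by lia.
- exists N.+1 => n ln.
  have /hN[p m h] : N%:Z <= n by lia.
  split; first by rewrite swap_pp // p (lin0 (linp repW 0)).
    rewrite swap_mp // m addr0 h (lin0 (linp repW 0)) delta0_0; last by lia.
    by rewrite subrr addr0.
  by rewrite swap_hp // h addr0 p (lin0 (linp repW 0)) scaler0 addr0.
(* The bracket with $J^-_{-1}$ lowers the mode to [n - 1], and [n] has to differ from 1 for the
   central term to vanish. *)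
- exists N.+2 => n ln.
  have /hN[p m h] : N%:Z <= n by lia.
  have /hN[p' m' h'] : N%:Z <= n - 1 by lia.
  split.
  - rewrite swap_pm // p (lin0 (linm repW (-1))) h' delta0_0; last by lia.
    by rewrite !addr0.
  - by rewrite swap_mm // m (lin0 (linm repW (-1))).
  - by rewrite swap_hm // h (lin0 (linm repW (-1))) m' scaler0 subr0.
Qed.

Hypothesis k2 : k%:~R + 2 != 0 :> C.

(** At [w] the term in [d] gives $-2j(j+1)$ and [cas 0] gives the opposite. The operator commutes
    with both letters up to a boundary term, which smoothness kills for large [N]. *)
Lemma univ_Cas v : exists N0 : nat, forall N : nat, (N0 <= N)%N -> Cas k%:~R N v = 0.
Proof.
have linC N : lin (@Cas C W k%:~R N).
  have lc i : lin (@cas C W i).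
    by move=> a u u'; rewrite /cas !(linp repW, linm repW, linh repW); lmodule C.
  move=> a u u'; rewrite /Cas (lind repW) lc.
  rewrite (eq_bigr (fun i : 'I_N => a *: cas i.+1%:Z u + cas i.+1%:Z u')); last first.
    by move=> i _; rewrite lc.
  by rewrite big_split -scaler_sumr /=; lmodule C.
move: v; apply: neg_gen => [||v [N0 hN]|v [N0 hN]].
- split=> [|a u v [N hN] [N' hN']]; first by exists 0%N => N _; rewrite (lin0 (linC N)).
  exists (N + N')%N => n ln; rewrite linC hN ?hN' ?scaler0 ?addr0 //; lia.
- have /lwP[[_ [dw nw]] hw mw _] := lww.
  exists 0%N => N _; rewrite /Cas big1; last first.
    move=> i _; rewrite /cas; have [-> [-> ->]] := nw i.+1%:Z isT.
    by rewrite (lin0 (linp repW _)) (lin0 (linm repW _)) (lin0 (linh repW _)) scaler0 !addr0.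
  rewrite scaler0 addr0 /cas oppr0 mw swap_mp // addr0 mw (lin0 (linp repW 0)).
  rewrite hw (linZ (linh repW 0)) hw dw /delta0 eqxx scale0r /dval /jC.
  by lmodule C.
- by exists N0 => N ln; rewrite Cas_p0 // hN // (lin0 (linp repW 0)).
- have [N1 hN1] := univ_smooth v; exists (N0 + N1).+1 => -[|N] // ln.
  rewrite Cas_m1 ?univ_K // hN; last by lia.
  have [|_ m h] := hN1 N.+1%:Z; first by lia.
  rewrite /casb m h !(lin0 (linm repW _), lin0 (linh repW _)).
  by rewrite subrr scaler0 addr0.
Qed.

End Structure.

(** * Weights and irreducibility *)

Lemma sum_by_key (V : nmodType) (I T : eqType) (s : seq I) (key : I -> T) (F : I -> V) :
  \sum_(i <- s) F i = \sum_(t <- undup (map key s)) \sum_(i <- s | key i == t) F i.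
Proof.
rewrite (exchange_big_dep predT) //=; apply: eq_big_seq => i si.
rewrite (eq_bigl (fun t => t == key i)); last by move=> t; rewrite eq_sym.
rewrite big_mkcond (bigD1_seq (key i)) ?undup_uniq ?mem_undup ?map_f //= eqxx.
by rewrite big1 ?addr0 // => t /negbTE ->.
Qed.

Section EigenProjection.
Variables (C : numClosedFieldType) (V : lmodType C) (A : V -> V) (P : V -> Prop).
Hypotheses (lA : lin A) (sP : subspace P) (PA : forall v, P v -> P (A v)).

(** Lagrange interpolation: the product of all [A - t] over the other eigenvalues kills the unwanted
    terms and scales the wanted ones by a non-zero constant. The filter [Q] allows a second
    projection for another operator. *)
Lemma eigen_proj (I : eqType) (s : seq I) (Q : pred I) (F : I -> V) (lam : I -> C) (c : C) :
  (forall i, A (F i) = lam i *: F i) -> P (\sum_(i <- s | Q i) F i) ->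
  P (\sum_(i <- s | Q i && (lam i == c)) F i).
Proof.
move=> AF PF.
pose T := [seq t <- map lam s | t != c].
have key (T' : seq C) : P (\sum_(i <- s | Q i) (\prod_(t <- T') (lam i - t)) *: F i).
  elim: T' => [|t T' IH].
    by rewrite (eq_bigr F) // => i _; rewrite big_nil scale1r.
  set S := \sum_(i <- s | Q i) _ in IH.
  have := subspaceB sP (PA IH) (subspaceZ sP t IH).
  rewrite /S (lin_sum lA) scaler_sumr -sumrB.
  congr (P _); apply: eq_bigr => i _.
  by rewrite big_cons (linZ lA) AF !scalerA -scalerBl; congr (_ *: _); ring.
have T0 : \prod_(t <- T) (c - t) != 0.
  rewrite prodf_seq_neq0; apply/allP => t; rewrite mem_filter => /andP[tc _].
  by rewrite implyTb subr_eq0 eq_sym.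
have := subspaceZ sP (\prod_(t <- T) (c - t))^-1 (key T).
congr (P _); rewrite (bigID (fun i => lam i == c)) /= addrC.
have -> : \sum_(i <- s | Q i && (lam i != c)) \prod_(t <- T) (lam i - t) *: F i = 0.
  apply: big1_seq => i /andP[/andP[_ lc] si].
  rewrite (_ : \prod_(t <- T) _ = 0) ?scale0r //.
  apply/eqP; rewrite prodf_seq_eq0; apply/hasP; exists (lam i); last by rewrite /= subrr.
  by rewrite mem_filter lc map_f.
rewrite add0r scaler_sumr; apply: eq_bigr => i /andP[_ /eqP ->].
by rewrite scalerA mulVf // scale1r.
Qed.

End EigenProjection.

(** For [n >= 0] both $n(n-j_2-1)$ and $-m(k+2)\ge m$ are non-negative, so both vanish. For [n < 0],
    $m\ge-n$ bounds the left side below by $n^2+n(k+1-j_2)>0$. *)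
Lemma weight_arith (k j2 n m : int) : k <= -3 -> k + 1 <= j2 <= 0 -> 0 <= m -> - m <= n ->
  n * n - n * (j2 + 1) - m * (k + 2) = 0 -> m = 0 /\ (n = 0 \/ j2 = 0 /\ n = 1).
Proof.
move=> k3 /andP[jk j0] m0 nm e.
have mk : m * (k + 2) <= - m by nia.
have [n0|n0] := lerP 0 n.
  have [j1|j1] := eqVneq j2 0.
    have : n * (n - 1) >= 0 by nia.
    by rewrite j1 in e *; split; nia.
  have : 0 <= - (n * (j2 + 1)) by nia.
  by split; nia.
have : m * (k + 2) <= - n * (k + 2) by nia.
have : - n * (k + 1 - j2) <= 0 by nia.
nia.
Qed.

Section Weights.
Variables (C : numClosedFieldType) (k j2 : int) (W : ghat_data C) (w : gcar W).
Hypothesis univ : universal k j2 W w.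
Implicit Types (v : gcar W) (y : seq bool).

Let repW : grep W. Proof. by case: univ. Qed.
Let lww : lw k j2 W w. Proof. by case: univ. Qed.

(** By [neg_gen] these monomials span, and their weights depend only on the two letter counts. *)
Definition actb y : gcar W :=
  foldr (fun b v => if b then Jp W 0 v else Jm W (-1) v) w y.

Definition wd y : C := dval C k j2 - (count negb y)%:R.
Definition wq y : C := - j2%:~R + 2 * ((count id y)%:R - (count negb y)%:R).

Definition weight (l q : C) v := dop W v = l *: v /\ J0 W 0 v = q *: v.

Lemma weight_subspace l q : subspace (weight l q).
Proof.
split=> [|a u v [du hu] [dv hv]].
  by rewrite /weight (lin0 (lind repW)) (lin0 (linh repW 0)) !scaler0.
by rewrite /weight (lind repW) (linh repW 0) du hu dv hv; split; lmodule C.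
Qed.

Lemma weight_p n l q v : weight l q v -> weight (l + n%:~R) (q + 2) (Jp W n v).
Proof.
move=> [dv hv]; split.
  by rewrite swap_dp // dv (linZ (linp repW n)) scalerDl.
by rewrite swap_hp // hv (linZ (linp repW n)) add0r -scalerDl.
Qed.

Lemma weight_m n l q v : weight l q v -> weight (l + n%:~R) (q - 2) (Jm W n v).
Proof.
move=> [dv hv]; split.
  by rewrite swap_dm // dv (linZ (linm repW n)) scalerDl.
by rewrite swap_hm // hv (linZ (linm repW n)) add0r -scalerBl.
Qed.

Lemma weight_h n l q v : weight l q v -> weight (l + n%:~R) q (J0 W n v).
Proof.
move=> [dv hv]; split.
  by rewrite swap_dh // dv (linZ (linh repW n)) scalerDl.
have := swap_act repW (Eh 0) (Eh n) v; rewrite /= evm_central hv (linZ (linh repW n)) => ->.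
by rewrite /delta0; case: ifP; rewrite ?addr0 // mulr0 scale0r addr0.
Qed.

Lemma weight_actb y : weight (wd y) (wq y) (actb y).
Proof.
elim: y => [|[] y IH].
- have /lwP[[_ [dw _]] hw _ _] := lww.
  by split; rewrite /wd /wq /= ?dw ?hw ?subr0 ?mulr0 ?addr0.
- have := weight_p 0 IH; congr weight; first by rewrite addr0.
  by rewrite /wq /= add0n natrD; ring.
- have := weight_m (-1) IH; congr weight; first by rewrite /wd /= natrD; ring.
  by rewrite /wq /= add0n natrD; ring.
Qed.

Lemma actb_span v : exists s : seq (C * seq bool), v = \sum_(p <- s) p.1 *: actb p.2.
Proof.
move: v; apply: (neg_gen univ) => [||v [s ->]|v [s ->]].
- split=> [|a u v [s ->] [t ->]]; first by exists [::]; rewrite big_nil.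
  exists ([seq (a * p.1, p.2) | p <- s] ++ t); rewrite big_cat big_map /=.
  by rewrite scaler_sumr; congr (_ + _); apply: eq_bigr => p _; rewrite scalerA.
- by exists [:: (1, [::])]; rewrite big_seq1 scale1r.
- exists [seq (p.1, true :: p.2) | p <- s]; rewrite big_map (lin_sum (linp repW 0)).
  by apply: eq_bigr => p _; rewrite (linZ (linp repW 0)).
- exists [seq (p.1, false :: p.2) | p <- s]; rewrite big_map (lin_sum (linm repW _)).
  by apply: eq_bigr => p _; rewrite (linZ (linm repW _)).
Qed.

Definition wt (p : C * seq bool) : C * C := (wd p.2, wq p.2).

Lemma weight_proj (P : gcar W -> Prop) (s : seq (C * seq bool)) mu :
  subspace P -> (forall v, P v -> P (dop W v)) -> (forall v, P v -> P (J0 W 0 v)) ->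
  P (\sum_(p <- s) p.1 *: actb p.2) -> P (\sum_(p <- s | wt p == mu) p.1 *: actb p.2).
Proof.
move=> sP Pd Ph Ps.
have wP p : weight (wd p.2) (wq p.2) (p.1 *: actb p.2).
  by apply: subspaceZ; [exact: weight_subspace|exact: weight_actb].
have h1 := eigen_proj (lind repW) sP Pd mu.1 (fun p => (wP p).1) Ps.
have := eigen_proj (linh repW 0) sP Ph mu.2 (fun p => (wP p).2) h1.
by congr P; apply: eq_bigl => p; rewrite /wt; case: mu.
Qed.

(** The terms of an expansion of [v], together with [-v], sum to zero. Projecting this relation to
    the weight of [v], with the zero subspace in [eigen_proj], leaves the terms of that weight;
    [None] indexes [-v]. *)
Lemma weight_words l q v : weight l q v -> exists s : seq (C * seq bool),
  all (fun p => wt p == (l, q)) s /\ v = \sum_(p <- s) p.1 *: actb p.2.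
Proof.
move=> wv; have [s vE] := actb_span v.
exists [seq p <- s | wt p == (l, q)]; split; first exact: filter_all.
have z0 : subspace (fun u : gcar W => u = 0).
  by split=> // a u u' -> ->; rewrite scaler0 addr0.
rewrite big_filter; apply/esym/eqP; rewrite -subr_eq0 addrC; apply/eqP.
pose F (o : option (C * seq bool)) := if o is Some p then p.1 *: actb p.2 else - v.
pose ld (o : option (C * seq bool)) := if o is Some p then wd p.2 else l.
pose lq (o : option (C * seq bool)) := if o is Some p then wq p.2 else q.
have wF o : weight (ld o) (lq o) (F o).
  case: o => [p|] /=.
    by apply: subspaceZ; [exact: weight_subspace|exact: weight_actb].
  by apply: subspaceN; [exact: weight_subspace|].
have F0 : \sum_(o <- None :: map Some s) F o = 0.
  by rewrite big_cons big_map /= -vE addNr.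
have d0 (u : gcar W) : u = 0 -> dop W u = 0 by move=> ->; exact: lin0 (lind repW).
have h0 (u : gcar W) : u = 0 -> J0 W 0 u = 0 by move=> ->; exact: lin0 (linh repW 0).
have h1 := eigen_proj (lind repW) z0 d0 l (fun o => (wF o).1) F0.
have := eigen_proj (linh repW 0) z0 h0 q (fun o => (wF o).2) h1.
rewrite big_cons /= !eqxx /= big_map => e.
by rewrite -[RHS]e.
Qed.

Lemma weight_nz l q v : weight l q v -> v != 0 -> exists y, l = wd y /\ q = wq y.
Proof.
move=> /weight_words[[|p s] [/= sl ->]]; first by rewrite big_nil eqxx.
by case/andP: sl => /eqP[<- <-] _ _; exists p.2.
Qed.

Lemma wd_inj y y' : wd y = wd y' -> count negb y = count negb y'.
Proof. by move=> /addrI /oppr_inj /eqP; rewrite eqr_nat => /eqP. Qed.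

Lemma wt_inj y y' : wd y = wd y' -> wq y = wq y' -> count id y = count id y'.
Proof.
move=> /wd_inj e; rewrite /wq e => /addrI.
have n2 : 2 != 0 :> C by rewrite pnatr_eq0.
by move=> /(mulfI n2) /addIr /eqP; rewrite eqr_nat => /eqP.
Qed.

Lemma weight_fin l q : exists ys : seq (seq bool),
  forall y, wd y = l -> wq y = q -> y \in ys.
Proof.
have [[y [ly qy]]|no] := pselect (exists y, wd y = l /\ wq y = q); last first.
  by exists [::] => y ly qy; case: no; exists y.
exists [seq val t | t <- enum {: (size y).-tuple bool}] => z lz qz.
have sz : size z == size y.
  have c1 : count negb z = count negb y by apply: wd_inj; rewrite lz ly.
  have c2 : count id z = count id y by apply: wt_inj; rewrite ?lz ?ly ?qz ?qy.
  by rewrite -(count_predC id z) -(count_predC id y) c1 c2.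
by apply/mapP; exists (Tuple sz) => //; rewrite mem_enum.
Qed.

Hypotheses (k3 : k <= -3) (jk : k + 1 <= j2 <= 0).

Lemma k2_neq0 : k%:~R + 2 != 0 :> C.
Proof.
have -> : k%:~R + 2 = (k + 2)%:~R :> C by rewrite intrD.
by rewrite intr_eq0; lia.
Qed.

Lemma singular_weight y v : v != 0 -> weight (wd y) (wq y) v ->
  (forall n : int, 0 < n -> [/\ Jp W n v = 0, Jm W n v = 0 & J0 W n v = 0]) ->
  Jm W 0 v = 0 ->
  count negb y = 0%N /\ (count id y = 0%N \/ j2 = 0 /\ count id y = 1%N).
Proof.
move=> v0 [dv hv] nv mv.
have [N /(_ N (leqnn N))] := univ_Cas univ k2_neq0 v.
rewrite /Cas big1; last first.
  move=> i _; rewrite /cas; have [|-> -> ->] := nv i.+1%:Z => //.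
  by rewrite (lin0 (linp repW _)) (lin0 (linm repW _)) (lin0 (linh repW _)) scaler0 !addr0.
rewrite scaler0 addr0 /cas oppr0 mv swap_mp // addr0 mv (lin0 (linp repW 0)).
rewrite hv (linZ (linh repW 0)) hv dv /delta0 eqxx scale0r.
(* [m] counts the steps below the top and [a - m] is the charge, at least [-m]; the scalar is twice
   the expression in [weight_arith]. *)
set m := count negb y; set a := count id y.
have -> : (2 * (k%:~R + 2)) *: (wd y *: v)
      + (0 + (0 - wq y *: v + 0) + 2^-1 *: (wq y *: (wq y *: v)))
  = (2 * (((a%:Z - m%:Z) ^+ 2 - (a%:Z - m%:Z) * (j2 + 1)) - m%:Z * (k + 2))%:~R) *: v.
  have := k2_neq0; rewrite /wd /wq -/m -/a /dval /jC => nk.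
  by lmodule C.
move=> /eqP; rewrite scaler_eq0 (negbTE v0) orbF mulf_eq0 pnatr_eq0 /= intr_eq0 => /eqP e.
rewrite expr2 in e.
have m0 : 0 <= m%:Z by [].
have nm : - m%:Z <= a%:Z - m%:Z by lia.
by have [m1 a1] := weight_arith k3 jk m0 nm e; split; lia.
Qed.

(** Among the weight vectors of [R] take one with least [m], and then least number of letters
    $J^+_0$. It is singular, so [singular_weight] places it at the top. *)
Lemma submodule_lw (R : gcar W -> Prop) v : subspace R ->
  (forall x u, R u -> R (act W x u)) -> R v -> v != 0 -> R w.
Proof.
move=> sR Ract Rv v0.
pose Q m a := exists y u, [/\ count negb y = m, count id y = a, R u, u != 0
  & weight (wd y) (wq y) u].
have Qnz l q u : R u -> u != 0 -> weight l q u ->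
    exists y, [/\ l = wd y, q = wq y & Q (count negb y) (count id y)].
  move=> Ru u0 wu; have [y [ly qy]] := weight_nz wu u0.
  by exists y; split=> //; exists y, u; split=> //; rewrite -ly -qy.
have exQ : exists m, `[< exists a, Q m a >].
  have [s vE] := actb_span v.
  have [mu [_ mu0]] : exists mu, mu \in undup (map wt s) /\
      \sum_(p <- s | wt p == mu) p.1 *: actb p.2 != 0.
    apply: contra_notP (elimN eqP v0) => no.
    rewrite vE (sum_by_key _ wt) big1_seq // => mu /= mus.
    by apply: contra_notP no => /eqP nz; exists mu.
  have Rmu : R (\sum_(p <- s | wt p == mu) p.1 *: actb p.2).
    by apply: weight_proj => //; [exact: (Ract Ed) | exact: (Ract (Eh 0)) | rewrite -vE].
  have wmu : weight mu.1 mu.2 (\sum_(p <- s | wt p == mu) p.1 *: actb p.2).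
    apply: subspace_sum; first exact: weight_subspace.
    move=> p /eqP <-; apply: subspaceZ; first exact: weight_subspace.
    exact: weight_actb.
  have [y [_ _ Qy]] := Qnz _ _ _ Rmu mu0 wmu.
  by exists (count negb y); apply/asboolP; exists (count id y).
have [m /asboolP[a0 Qa0] mmin] := ex_minnP exQ.
have exA : exists a, `[< Q m a >] by exists a0; apply/asboolP.
have [a /asboolP[y [u [ym ya Ru u0 wu]]] amin] := ex_minnP exA.
(* A positive mode would yield a non-zero weight vector of [R] with fewer letters $J^-_{-1}$,
   against minimality of [m]. *)
have lower (n : int) q u' : R u' -> weight (wd y + n%:~R) q u' -> 0 < n -> u' = 0.
  move=> Ru' wu' n0; apply/eqP; apply: contraT => nz.
  have [z [lz _ Qz]] := Qnz _ _ _ Ru' nz wu'.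
  have /mmin : `[< exists a, Q (count negb z) a >] by apply/asboolP; exists (count id z).
  have : ((count negb y)%:Z - n)%:~R = ((count negb z)%:Z)%:~R :> C.
    by move: lz; rewrite /wd intrB -addrA => /addrI lz; apply: oppr_inj; rewrite -lz; ring.
  by move=> /intr_inj; lia.
have [c0 ca] : count negb y = 0%N /\ (count id y = 0%N \/ j2 = 0 /\ count id y = 1%N).
  apply: (singular_weight u0 wu) => [n n0|].
    split; first exact: (lower n _ _ (Ract (Ep n) _ Ru) (weight_p n wu) n0).
      exact: (lower n _ _ (Ract (Em n) _ Ru) (weight_m n wu) n0).
    exact: (lower n _ _ (Ract (Eh n) _ Ru) (weight_h n wu) n0).
  apply/eqP; apply: contraT => nz.
  have [z [lz qz Qz]] := Qnz _ _ _ (Ract (Em 0) _ Ru) nz (weight_m 0 wu).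
  rewrite addr0 in lz; have nz' := wd_inj lz; rewrite -nz' ym in Qz.
  have /amin : `[< Q m (count id z) >] by apply/asboolP.
  have : ((count id y)%:Z - 1)%:~R = ((count id z)%:Z)%:~R :> C.
    move: qz; rewrite /wq -nz' -addrA => /addrI qz.
    have n2 : 2 != 0 :> C by rewrite pnatr_eq0.
    apply: (mulfI n2); rewrite intrB -!pmulrn.
    rewrite (_ : 2 * _ = 2 * ((count id y)%:R - (count negb y)%:R) - 2
      + 2 * (count negb y)%:R); last by ring.
    by rewrite qz; ring.
  by move=> /intr_inj; lia.
have [s [sw uE]] := weight_words wu.
have wds p : p \in s -> count negb p.2 = 0%N /\ count id p.2 = count id y.
  move=> ps; have /eqP[lp qp] := allP sw _ ps.
  by rewrite (wd_inj lp) (wt_inj lp qp) c0.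
case: ca => [a0'|[j0 a1]].
  have nil p : p \in s -> p.2 = [::].
    move=> /wds[c1 c2]; apply/nilP; rewrite /nilp -(count_predC id p.2).
    by rewrite c2 a0' c1.
  have uw : u = (\sum_(p <- s) p.1) *: w.
    by rewrite uE scaler_suml; apply: eq_big_seq => p /nil ->.
  have cn0 : \sum_(p <- s) p.1 != 0.
    by apply: contraNneq u0 => e; rewrite uw e scale0r.
  by rewrite -[w](scalerK cn0) -uw; apply: (subspaceZ sR).
(* The exceptional solution at [j2 = 0] is the weight of $J^+_0w$, which is zero there, so it
   carries no non-zero vector. *)
case/eqP: u0; rewrite uE big1_seq // => p /wds[c1 c2].
have -> : p.2 = [:: true].
  have : size p.2 = 1%N by rewrite -(count_predC id p.2) c2 a1 c1.
  by case: (p.2) c2 => [|[] []] //=; rewrite a1.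
rewrite /actb /=; have /lwP[_ _ _ ->] := lww => //.
by rewrite scaler0.
Qed.

End Weights.

(** * The contravariant pairing *)

Section FinitePairing.
Variables (C : numClosedFieldType) (X V : lmodType C) (F : X -> V -> C).
Hypothesis Fl : forall a u w v, F (a *: u + w) v = a * F u v + F w v.
Hypothesis Fr : forall u, lin_form (F u).

Definition inspan (bs : seq V) (v : V) :=
  forall P : V -> Prop, subspace P -> (forall b, b \in bs -> P b) -> P v.

(** A functional vanishing on the common kernel of finitely many others is a combination of them.
    Given [y] that isolates [c], a multiple of [c] is subtracted from [b] to reduce to [bs]. *)
Lemma pairing_comb (bs : seq V) b :
  (forall x, (forall c, c \in bs -> F x c = 0) -> F x b = 0) ->
  exists v, inspan bs v /\ forall x, F x b = F x v.
Proof.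
elim: bs b => [|c bs IH] b kb.
  exists 0; split=> [P sP _|x]; first exact: sP.1.
  by rewrite kb // (lin_form0 (Fr x)).
have [[y [ybs yc]]|no] := pselect (exists y, (forall e, e \in bs -> F y e = 0) /\ F y c <> 0);
    last first.
  have [x xbs|v [sv vE]] := IH b.
    apply: kb => e; rewrite inE => /predU1P[->|/xbs //].
    by apply: contra_notP no => xc; exists x.
  by exists v; split=> // P sP Pb; apply: sv => // e eb; apply: Pb; rewrite inE eb orbT.
have yc0 : F y c != 0 by apply/eqP.
have [x xbs|v [sv vE]] := IH (- (F y b / F y c) *: c + b).
  rewrite Fr; have := kb (- (F x c / F y c) *: y + x); rewrite !Fl => k0.
  have -> : F x b = F x c / F y c * F y b.
    apply/eqP; rewrite -subr_eq0 addrC -mulNr k0 // => e.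
    rewrite inE Fl => /predU1P[->|eb]; first by field.
    by rewrite (ybs e eb) (xbs e eb) mulr0 addr0.
  by field.
exists ((F y b / F y c) *: c + v); split=> [P sP Pb|x].
  apply: sP.2; first by apply: Pb; rewrite inE eqxx.
  by apply: sv => // e eb; apply: Pb; rewrite inE eb orbT.
by rewrite Fr -vE Fr; ring.
Qed.

Hypothesis Fnd : forall v, (forall x, F x v = 0) -> v = 0.

(** Values are corrected one vector at a time. If no [y] isolates the new vector [c], non-degeneracy
    puts [c] in the span of the old ones and linearity forces its value. *)
Lemma pairing_surj (phi : V -> C) (bs : seq V) : lin_form phi ->
  exists x, forall b, b \in bs -> F x b = phi b.
Proof.
move=> lphi; elim: bs => [|c bs [x0 x0E]]; first by exists 0.
have [[y [ybs yc]]|no] := pselect (exists y, (forall e, e \in bs -> F y e = 0) /\ F y c <> 0).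
  have yc0 : F y c != 0 by apply/eqP.
  exists (((phi c - F x0 c) / F y c) *: y + x0) => b.
  rewrite inE Fl => /predU1P[->|bb]; first by field.
  by rewrite (ybs b bb) (x0E b bb) mulr0 add0r.
have [x xbs|v [sv vE]] := @pairing_comb bs c.
  by apply: contra_notP no => xc; exists x.
have cv : c = v.
  apply/eqP; rewrite -subr_eq0; apply/eqP/Fnd => x.
  by rewrite addrC -scaleN1r Fr vE; ring.
exists x0 => b; rewrite inE => /predU1P[->|/x0E //].
rewrite cv; apply: (sv (fun u => F x0 u = phi u)) => //; split.
  by rewrite (lin_form0 (Fr x0)) (lin_form0 lphi).
by move=> a u u' e e'; rewrite Fr lphi e e'.
Qed.

End FinitePairing.

Section Pairing.
Variables (C : numClosedFieldType) (k j2 : int).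
Variables (W W' : ghat_data C) (w : gcar W) (w' : gcar W').
Hypotheses (k3 : k <= -3) (jk : k + 1 <= j2 <= 0).
Hypotheses (uW : universal k j2 W w) (uW' : universal k j2 (chev W') w').

(** [u] pulled back to [W] is a lowest weight vector of the twisted full dual, and universality of
    [chev W'] sends [w'] to it. Its value at [w] is [u x = 1]. *)
Lemma pairing_exists : exists F : gcar W' -> gcar W -> C,
  [/\ forall a u u' v, F (a *: u + u') v = a * F u v + F u' v, forall u, lin_form (F u),
      F w' w = 1 & forall x u v, F (act W' x u) v = gsign C x * F u (act W (gopp x) v)].
Proof.
have [repW lww univW] := uW; have [_ _ univW'] := uW'.
have [M [x [u [[rM lx lu ux] [un ul]]]]] := coind_lw C k j2.
have [f [[lf fa] [fw _]]] := univW M x rM lx.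
pose u0 : gcar W -> C^o := fun v => u (f v).
have lu0 : lin_form u0 by move=> a v v'; rewrite /u0 lf lu.
pose U0 : gcar (dual repW) := smk (lin_form_subspace W) lu0.
have rD : grep (chev (dual repW)) by apply/chev_grep/dual_grep.
have DE y v : smval (act (dual repW) y U0) v = gsign C y * u (act M (gopp y) (f v)).
  by rewrite smval_act /gdual /= /u0 fa.
have lD : lw k j2 (chev (dual repW)) U0.
  (* Twist and [gopp] turn positive modes into letters outside [q]; the zero modes of $J^\pm$ in [q]
     go outside [q] or, if [j2 = 0], into [inl] with character 0. *)
  have Z y v : ~~ inq j2 y || inl j2 y && (chi k j2 y == 0 :> C) -> u (act M y (f v)) = 0.
    by case/orP=> [/un //|/andP[/ul -> /eqP ->]]; rewrite mul0r.
  move=> a qa; apply: smval_inj; apply/funext => v.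
  have SE (c : C) : smval (c *: U0) v = c * u (f v) by [].
  rewrite SE; case: a qa => [n|n|n||] /= qn.
  - by rewrite mul0r -[LHS]/(smval (act (dual repW) (Em n) U0) v) DE Z ?mulr0 //= eqxx; lia.
  - by rewrite mul0r -[LHS]/(smval (act (dual repW) (Ep n) U0) v) DE Z ?mulr0 //= eqxx; lia.
  - rewrite -[LHS]/(- smval (act (dual repW) (Eh n) U0) v) DE.
    have [->|n0] := eqVneq n 0; first by rewrite ul //=; ring.
    by rewrite Z /=; [ring|lia].
  - by rewrite -[LHS]/(smval (act (dual repW) Ek U0) v) DE ul //=; ring.
  - by rewrite -[LHS]/(smval (act (dual repW) Ed U0) v) DE ul //=; ring.
have [h [/gmap_act /gmap_chev /gmap_act [lh ha] [hw _]]] := univW' _ _ rD lD.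
exists (fun x v => smval (h x) v); split=> [a x1 x2 v|x1||y x1 v].
- by rewrite lh.
- exact: smP (h x1).
- by rewrite hw /= /u0 fw.
- by rewrite ha smval_act.
Qed.

Lemma gopp_act (F : gcar W' -> gcar W -> C) :
  (forall x u v, F (act W' x u) v = gsign C x * F u (act W (gopp x) v)) ->
  forall x u v, F u (act W x v) = gsign C x * F (act W' (gopp x) u) v.
Proof.
by move=> Fc [n|n|n||] u v; rewrite Fc /= ?opprK; ring.
Qed.

(** Each radical is a submodule avoiding the lowest weight vector, because [F w' w = 1];
    [submodule_lw] makes both zero. Surjectivity is then obtained weight by weight. *)
Lemma contra_iso_universal : contra_iso W W'.
Proof.
have [F [Fl Fr Fw Fc]] := pairing_exists.
have Fc' := gopp_act Fc.
have [repW _ _] := uW; have [repW' _ _] := uW'.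
have F0l v : F 0 v = 0.
  by have := Fl (-1) 0 0 v; rewrite scaler0 addr0 => {1}->; ring.
have Fndr v : (forall u, F u v = 0) -> v = 0.
  move=> Fv; apply/eqP; apply: contraT => v0.
  have : forall u, F u w = 0.
    apply: (submodule_lw uW k3 jk (R := fun v => forall u, F u v = 0) _ _ Fv v0).
      by split=> [u|a v1 v2 e1 e2 u]; rewrite ?(lin_form0 (Fr u)) // Fr e1 e2 mulr0 addr0.
    by move=> x v1 e1 u; rewrite Fc' e1 mulr0.
  by move=> /(_ w') /eqP; rewrite Fw oner_eq0.
have Fndl u : (forall v, F u v = 0) -> u = 0.
  move=> Fu; apply/eqP; apply: contraT => u0.
  have : forall v, F w' v = 0.
    apply: (submodule_lw uW' k3 jk (R := fun u : gcar (chev W') => forall v, F u v = 0) _ _ Fu u0).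
      by split=> [v|a v1 v2 e1 e2 v]; rewrite ?F0l // Fl e1 e2 mulr0 addr0.
    have e x u1 v : (forall v, F u1 v = 0) -> F (act W' x u1) v = 0.
      by move=> e1; rewrite Fc e1 mulr0.
    move=> [n|n|n||] u1 e1 v; [exact: (e (Em n))|exact: (e (Ep n))| |exact: (e Ek)|exact: (e Ed)].
    rewrite /= -[- _]addr0 -scaleN1r Fl F0l (e (Eh n)) //; ring.
  by move=> /(_ w) /eqP; rewrite Fw oner_eq0.
have Fd u v : F (dop W' u) v = F u (dop W v) by rewrite (Fc Ed) mul1r.
have Fh u v : F (J0 W' 0 u) v = - F u (J0 W 0 v) by rewrite (Fc (Eh 0)) /= oppr0 mulN1r.
have FZl a u v : F (a *: u) v = a * F u v by rewrite -[_ *: _]addr0 Fl F0l addr0.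
have FZr a u v : F u (a *: v) = a * F u v.
  by rewrite -[_ *: _]addr0 Fr (lin_form0 (Fr u)) addr0.
have FSl (I : Type) (s : seq I) (P : pred I) (G : I -> gcar W') v :
    F (\sum_(i <- s | P i) G i) v = \sum_(i <- s | P i) F (G i) v.
  by elim/big_rec2: _ => [|i x y _ <-]; rewrite ?F0l // -[G i]scale1r Fl mul1r scale1r.
have FSr (I : Type) (s : seq I) (P : pred I) (G : I -> gcar W) u :
    F u (\sum_(i <- s | P i) G i) = \sum_(i <- s | P i) F u (G i).
  elim/big_rec2: _ => [|i x y _ <-]; first exact: (lin_form0 (Fr u)).
  by rewrite -[G i]scale1r Fr mul1r scale1r.
(* Weights on the left are taken in [chev W'], where $J^0$ changes sign, so that vectors pair only
   if their weights are equal rather than opposite. *)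
have Fwt l q l' q' (u : gcar (chev W')) v : weight l q u -> weight l' q' v ->
    (l, q) != (l', q') -> F u v = 0.
  move=> [du hu] [dv hv] ne; apply/eqP.
  have e1 : (l - l') * F u v = 0.
    by rewrite mulrBl -FZl -du (Fd u) dv FZr subrr.
  have e2 : (q - q') * F u v = 0.
    rewrite mulrBl -FZl -hu /= -[- J0 W' 0 u]scaleN1r FZl Fh hv FZr; ring.
  move/eqP: e1; rewrite mulf_eq0 subr_eq0; case: eqP => [el _|//].
  by move/eqP: e2; rewrite mulf_eq0 subr_eq0; case: eqP => [eq|//]; rewrite el eq eqxx in ne.
have wwt y : weight (wd C k j2 y) (wq C j2 y) (actb w y) := weight_actb uW y.
have wwt' y : weight (wd C k j2 y) (wq C j2 y) (actb (W := chev W') w' y) := weight_actb uW' y.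
exists F; split=> [u|].
  split=> //; have [s sE] := actb_span uW' u.
  exists [seq wt k j2 p | p <- s] => v l q dv hv nin.
  rewrite sE FSl big1_seq // => p /= ps; rewrite FZl (Fwt _ _ l q _ _ (wwt' p.2)) ?mulr0 //.
  by apply: contraNneq nin => <-; apply: (map_f (wt k j2)).
split=> //; split=> [u1 u2 e|].
  apply/eqP; rewrite -subr_eq0; apply/eqP/Fndl => v.
  by rewrite addrC -scaleN1r Fl e; ring.
split=> [phi lphi [S phiS]|].
  (* Interpolate [phi] on the finitely many words of this weight, then keep only the component of
     the solution in the same weight. *)
  have step l q : exists x, (forall v, weight l q v -> F x v = phi v) /\
      forall l' q' v, weight l' q' v -> (l, q) != (l', q') -> F x v = 0.
    have [ys ysP] := weight_fin k j2 l q.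
    have [x0 x0E] := pairing_surj Fl Fr Fndr (map (actb w) ys) lphi.
    have [s sE] := actb_span uW' x0.
    exists (\sum_(p <- s | wt k j2 p == (l, q)) p.1 *: actb (W := chev W') w' p.2).
    split=> [v wv|l' q' v wv ne]; last first.
      rewrite FSl big1 // => p /eqP pE.
      by rewrite FZl (Fwt _ _ _ _ _ _ (wwt' p.2) wv) ?mulr0 // -[(_, _)]/(wt k j2 p) pE.
    have -> : phi v = F x0 v.
      have [t [tw ->]] := weight_words uW wv.
      have PS : subspace (fun u => phi u = F x0 u).
        split; first by rewrite (lin_form0 lphi) (lin_form0 (Fr x0)).
        by move=> a u1 u2 e1 e2; rewrite lphi Fr e1 e2.
      rewrite big_seq; apply: (subspace_sum PS) => p pt; apply: (subspaceZ PS).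
      by have /eqP[lp qp] := allP tw _ pt; rewrite x0E // map_f // ysP.
    rewrite sE !FSl [RHS](bigID (fun p => wt k j2 p == (l, q))) /= [X in _ + X]big1 ?addr0 //.
    by move=> p pE; rewrite FZl (Fwt _ _ _ _ _ _ (wwt' p.2) wv) ?mulr0.
  have all_S (T : seq (C * C)) : uniq T -> exists x, forall l q v, weight l q v ->
      F x v = if (l, q) \in T then phi v else 0.
    elim: T => [_|[l0 q0] T IH /andP[nT /IH[x xE]]]; first by exists 0.
    have [x1 [x1E x1N]] := step l0 q0.
    exists (x + x1) => l q v wv; rewrite -[x]scale1r Fl (xE _ _ _ wv) mul1r inE.
    case: eqP => [[el eq]|/eqP ne] /=.
      by rewrite el eq in wv *; rewrite (negbTE nT) add0r x1E.
    by rewrite (x1N l q) ?addr0 // eq_sym.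
  have [x xE] := all_S _ (undup_uniq S); exists x => v.
  have [s ->] := actb_span uW v.
  have PS : subspace (fun u => F x u = phi u).
    split; first by rewrite (lin_form0 lphi) (lin_form0 (Fr x)).
    by move=> a u1 u2 e1 e2; rewrite lphi Fr e1 e2.
  apply: (subspace_sum PS) => p _; apply: (subspaceZ PS).
  rewrite (xE _ _ _ (wwt p.2)) mem_undup; case: ifPn => // nin.
  by rewrite (phiS _ _ _ (wwt p.2).1 (wwt p.2).2 nin).
split=> [n u v|]; first by rewrite (Fc (Ep n)) mulN1r.
split=> [n u v|]; first by rewrite (Fc (Em n)) mulN1r.
split=> [n u v|]; first by rewrite (Fc (Eh n)) mulN1r.
by split=> u v; rewrite ?(Fc Ek) ?(Fc Ed) mul1r.
Qed.

End Pairing.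

(** * Transport of the pairing along the Chevalley twist and the spectral flow *)

Lemma contra_iso_chev (C : numClosedFieldType) (M N : ghat_data C) :
  contra_iso (chev M) (chev N) -> contra_iso M N.
Proof.
case=> F [Fr [Fl [Fi [Fs [Fp [Fm [Fh [Fk Fd]]]]]]]].
have F0 v : F 0 v = 0 by have := Fl (-1) 0 0 v; rewrite scaler0 addr0 => {1}->; ring.
have FNl u v : F (- u) v = - F u v.
  by have := Fl (-1) u 0 v; rewrite scaleN1r addr0 F0 => ->; ring.
have FNr u v : F u (- v) = - F u v.
  have := (Fr u).1 (-1) v 0; rewrite scaleN1r addr0 (lin_form0 (Fr u).1) => ->; ring.
exists F; split=> [u|].
  split; first exact: (Fr u).1.
  have [S FS] := (Fr u).2; exists [seq (p.1, - p.2) | p <- S] => v l q dv hv nin.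
  apply: (FS v l (- q)) => //=; first by rewrite hv scaleNr.
  by apply: contra nin => inS; apply/mapP; exists (l, - q) => //=; rewrite opprK.
split=> //; split=> //; split=> [phi lphi [S phiS]|].
  apply: Fs => //; exists [seq (p.1, - p.2) | p <- S] => v l q dv /= hv nin.
  apply: (phiS v l (- q)) => //; first by rewrite scaleNr -hv opprK.
  by apply: contra nin => inS; apply/mapP; exists (l, - q) => //=; rewrite opprK.
split=> [n u v|]; first exact: Fm.
split=> [n u v|]; first exact: Fp.
split=> [n u v|]; last by [].
by have := Fh n u v; rewrite /= FNl FNr opprK => <-; rewrite opprK.
Qed.

(** The same pairing works: the contragredient action negates modes, so a shift by [s] on one side
    matches a shift by [-s] on the other. Only the supports have to be relabelled. *)
Lemma contra_iso_sflow (C : numClosedFieldType) (M N : ghat_data C) (c : C) (s : int) :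
  is_rep M -> (forall v, Kop M v = c *: v) -> contra_iso M N ->
  contra_iso (sflow s M) (sflow (- s) N).
Proof.
move=> /is_rep_grep rM Kc [F [Fr [Fl [Fi [Fs [Fp [Fm [Fh [Fk Fd]]]]]]]]].
have F0 v : F 0 v = 0 by have := Fl (-1) 0 0 v; rewrite scaler0 addr0 => {1}->; ring.
have FDl u u' v : F (u + u') v = F u v + F u' v by rewrite -[u]scale1r Fl mul1r scale1r.
have FZl a u v : F (a *: u) v = a * F u v by rewrite -[_ *: _]addr0 Fl F0 addr0.
have FNl u v : F (- u) v = - F u v by rewrite -scaleN1r FZl mulN1r.
have FDr u v v' : F u (v + v') = F u v + F u v'.
  by rewrite -[v]scale1r (Fr u).1 mul1r scale1r.
have FZr a u v : F u (a *: v) = a * F u v.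
  by rewrite -[_ *: _]addr0 (Fr u).1 (lin_form0 (Fr u).1) addr0.
have FNr u v : F u (- v) = - F u v by rewrite -scaleN1r FZr mulN1r.
(* [t] sends a weight of [M] to the weight of the same vector in [sflow s M]; it is a map of pairs
   because [K] is the scalar [c]. Its inverse is [t']. *)
pose t : C * C -> C * C := fun p =>
  (p.1 + s%:~R / 2 * p.2 - s%:~R ^+ 2 / 4 * c, p.2 - s%:~R * c).
pose t' : C * C -> C * C := fun p =>
  (p.1 - s%:~R / 2 * (p.2 + s%:~R * c) + s%:~R ^+ 2 / 4 * c, p.2 + s%:~R * c).
have tK : cancel t' t by case=> l q; rewrite /t /t' /=; congr pair; ring.
have t'K : cancel t t' by case=> l q; rewrite /t /t' /=; congr pair; ring.
have wE v l q : (dop (sflow s M) v = l *: v /\ J0 (sflow s M) 0 v = q *: v) <->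
    (dop M v = (t' (l, q)).1 *: v /\ J0 M 0 v = (t' (l, q)).2 *: v).
  rewrite /= /delta0 eqxx Kc; split=> -[dv hv].
    have hv' : J0 M 0 v = (q + s%:~R * c) *: v.
      by rewrite scalerDl -hv; lmodule C.
    split=> //; rewrite hv' in dv.
    have -> : dop M v = l *: v - (s%:~R / 2) *: ((q + s%:~R * c) *: v)
      + (s%:~R ^+ 2 / 4) *: (c *: v) by rewrite -dv; lmodule C.
    by lmodule C.
  by rewrite dv hv; split; lmodule C.
exists F; split=> [u|].
  split; first exact: (Fr u).1.
  have [S FS] := (Fr u).2; exists [seq t p | p <- S] => v l q dv hv nin.
  have [dv' hv'] := (wE v l q).1 (conj dv hv).
  apply: (FS _ _ _ dv' hv'); rewrite -surjective_pairing.
  by apply: contra nin => /(map_f t); rewrite tK.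
split=> //; split=> //; split=> [phi lphi [S phiS]|].
  apply: Fs => //; exists [seq t' p | p <- S] => v l q dv hv nin.
  have [dv' hv'] : dop (sflow s M) v = (t (l, q)).1 *: v /\
      J0 (sflow s M) 0 v = (t (l, q)).2 *: v.
    by apply/wE; rewrite -surjective_pairing t'K.
  apply: (phiS _ _ _ dv' hv'); rewrite -surjective_pairing.
  by apply: contra nin => /(map_f t'); rewrite t'K.
split=> [n u v|] /=; first by rewrite opprK Fp opprD.
split=> [n u v|]; first by rewrite Fm opprB addrC.
split=> [n u v|].
  rewrite FDl FDr !FNl !FNr /delta0 oppr_eq0 Fh; case: eqP => _.
    by rewrite FZl FZr Fk mulrNz; ring.
  by rewrite F0 (lin_form0 (Fr u).1); ring.
split=> // u v.
by rewrite !(FDl, FDr, FNl, FNr, FZl, FZr) Fd Fh Fk oppr0 mulrNz; ring.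
Qed.

Theorem theorem3p14 (C : numClosedFieldType) (k j2 s : int) :
  k <= -3 -> k + 1 <= j2 <= -1 ->
  (forall (W0 : ghat_data C) w0 (W0' : ghat_data C) w0',
     is_prolong_triv k W0 w0 -> is_prolong_triv k W0' w0' ->
     contra_iso (sflow s W0) (sflow (- s) W0')) /\
  (forall (Wp : ghat_data C) wp (Wm : ghat_data C) wm,
     is_prolong_plus k j2 Wp wp -> is_prolong_minus k j2 Wm wm ->
     contra_iso (sflow s Wp) (sflow (- s) Wm) /\
     contra_iso (sflow s Wm) (sflow (- s) Wp)).
Proof.
move=> k3 /andP[jk j1].
have jk0 : k + 1 <= 0 <= (0 : int) by rewrite lexx andbT; lia.
have jkj : k + 1 <= j2 <= 0 by lia.
have j0 : j2 < 0 by lia.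
split=> [W0 w0 W0' w0' p p'|Wp wp Wm wm pp pm].
  have u := prolong_triv_universal p.
  apply: (contra_iso_sflow s p.1 (univ_K u)).
  (* The trivial module is stable under exchanging $J^+$ and $J^-$, so the twisted second copy is
     again a prolongation of it. *)
  exact: contra_iso_universal k3 jk0 u (prolong_triv_universal (prolong_triv_chev p')).
have up := prolong_plus_universal j0 pp.
have um := prolong_plus_universal j0 (prolong_minus_chev pm).
split.
  apply: (contra_iso_sflow s pp.1 (univ_K up)).
  exact: contra_iso_universal k3 jkj up um.
apply: (contra_iso_sflow s pm.1 (univ_K um)).
(* Twisting both sides makes the module over $D^-_j$ a lowest weight module; the other side is then
   twisted twice, which restores it. *)
apply: contra_iso_chev.
exact: contra_iso_universal k3 jkj um (universal_chev2 up).
Qed.
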